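(* If $P$ is a grid polygon, then $\operatorname{area}(P)=6\operatorname{cyc}(P)-6$ if and only if $P$ is a tree of unit hexagons.
   Context: Consider the infinite triangular grid in the plane, scaled so that each equilateral triangular grid cell has side length $1$ and oriented so that some of the grid lines are horizontal. The sides of the grid cells are called panes. A grid polygon is a (not necessarily convex) polygon (the closed region, including its boundary) whose boundary is a union of panes; the boundary, viewed as a closed curve, does not intersect itself. Let $P$ be a grid polygon with boundary panes $b_1,\ldots,b_n$, listed clockwise. From the midpoint of a boundary pane $b_i$, emit a beam of light into the interior of $P$ so that the beam forms a $60^\circ$ angle with $b_i$ and travels either northeast (direction $60^\circ$), southeast (direction $-60^\circ$), or west (direction $180^\circ$), depending on the orientation of $b_i$ (exactly one of these three directions satisfies the requirements). The beam travels in a straight line through the interior of $P$ until reaching the midpoint of a different boundary pane $b_{\pi(i)}$, which it meets at a $60^\circ$ angle. This defines a permutation $\pi=\pi_P\colon[n]\to[n]$, where $[n]=\{1,\ldots,n\}$, called the billiards permutation of $P$. $\operatorname{area}(P)$ denotes the number of triangular grid cells in $P$. $\operatorname{cyc}(P)$ denotes the number of cycles of $\pi_P$. A unit hexagon is a grid polygon that is a regular hexagon of side length $1$. A tree of unit hexagons is any grid polygon $P_k$ ($k\geq 1$) obtained as follows: $P_1$ is a unit hexagon, and for each $j\in\{2,\ldots,k\}$, $P_j=P_{j-1}\cup Q_j$, where $Q_j$ is a unit hexagon such that $P_{j-1}\cap Q_j$ is a single pane. *)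

(* Defs.v *)
From HB Require Import structures.
From mathcomp Require Import all_boot all_order all_algebra perm finmap.
From mathcomp Require Import zify.

Set Implicit Arguments.
Unset Strict Implicit.
Unset Printing Implicit Defensive.

Import Order.TTheory GRing.Theory Num.Theory.

Local Open Scope fset_scope.
Local Open Scope ring_scope.

(* The grid vertex (a, b) is the point a * (1, 0) + b * (1/2, sqrt 3 / 2) of   *)
(* the plane.                                                                  *)
Notation vertex := (int * int)%type.

(* A pane with endpoints v and w is encoded by v + w, that is, by twice its    *)
(* midpoint; this determines the (unordered) pair of adjacent vertices v, w.   *)
Notation pane := (int * int)%type.

(* (v, true) is the upward-pointing grid cell with lower left vertex v, and    *)
(* (v, false) is the downward-pointing one sharing its top right side.         *)
Notation cell := (vertex * bool)%type.

Definition e1 : vertex := (1, 0).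
Definition e2 : vertex := (0, 1).

Definition adjacent : rel vertex :=
  fun v w => w - v \in [:: e1; e2; e2 - e1; - e1; - e2; e1 - e2].

Definition cell_vertices (c : cell) : seq vertex :=
  let: (v, up) := c in
  if up then [:: v; v + e1; v + e2] else [:: v + e1; v + e2; v + e1 + e2].

Definition cell_panes (c : cell) : seq pane :=
  let: (v, up) := c in
  if up then [:: v + (v + e1); v + (v + e2); (v + e1) + (v + e2)]
  else [:: (v + e1) + (v + e2); (v + e1) + (v + e1 + e2);
           (v + e2) + (v + e1 + e2)].

(* A finite set of cells stands for the closed region they cover. *)
Definition region_vertices (P : {fset cell}) : {fset vertex} :=
  \bigcup_(c <- P) [fset v in cell_vertices c].

Definition region_panes (P : {fset cell}) : {fset pane} :=
  \bigcup_(c <- P) [fset q in cell_panes c].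

Definition boundary_panes (P : {fset cell}) : {fset pane} :=
  [fset q in region_panes P | #|` [fset c in P | q \in cell_panes c]| == 1%N].

(* Rotation of the plane by -60 degrees: e1 |-> e1 - e2 and e2 |-> e1. *)
Definition cw60 (u : vertex) : vertex := (u.1 + u.2, - u.1).

(* The topological boundary of P is the simple closed curve through the        *)
(* vertices s, in this cyclic order.  It is traversed clockwise: the cell on   *)
(* the right-hand side of each step belongs to P.                              *)
Definition clockwise_boundary (P : {fset cell}) (s : seq vertex) : Prop :=
  [/\ (2 < size s)%N, uniq s, cycle adjacent s,
      [seq v + next s v | v <- s] =i boundary_panes P &
      {in s, forall v, exists2 c, c \in P &
         perm_eq (cell_vertices c)
                 [:: v; next s v; v + cw60 (next s v - v)]}].

(* The start of the clockwise list of boundary vertices is arbitrary and is    *)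
(* part of the data.                                                           *)
Record grid_polygon := GridPolygon {
  cells :> {fset cell};
  boundary_vertices : seq vertex;
  grid_polygonP : clockwise_boundary cells boundary_vertices
}.

Definition area (P : grid_polygon) : nat := #|` cells P|.

Definition panes (P : grid_polygon) : seq pane :=
  [seq v + next (boundary_vertices P) v | v <- boundary_vertices P].

Definition northeast : vertex := e2.
Definition southeast : vertex := e1 - e2.
Definition west : vertex := - e1.
Definition beam_directions : seq vertex := [:: northeast; southeast; west].

(* Because panes are doubled midpoints, adding the unit vector d to q moves    *)
(* the beam by 1/2.  A beam crosses a cell from the midpoint of one side to    *)
(* that of another, parallel to the third and hence at 60 degrees to both.     *)
Definition crosses (P : {fset cell}) (d : vertex) (q : pane) : Prop :=
  exists2 c, c \in P & (q \in cell_panes c) && (q + d \in cell_panes c).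

(* The beam emitted from the boundary pane q first meets the boundary again at *)
(* the pane r, after crossing k cells of P.                                    *)
Definition beam (P : {fset cell}) (q r : pane) : Prop :=
  exists2 d, d \in beam_directions & exists k,
    [/\ (0 < k)%N,
        (forall i, (i < k)%N -> crosses P d (q + d *+ i)),
        (forall i, (0 < i < k)%N -> q + d *+ i \notin boundary_panes P),
        r = q + d *+ k & r \in boundary_panes P].

Lemma mem_region_panes P q :
  reflect (exists2 c, c \in P & q \in cell_panes c) (q \in region_panes P).
Proof.
apply: (iffP (bigfcupP _ _ _ _)) => [[c /andP[cP _]]|[c cP]].
  by rewrite inE => qc; exists c.
by move=> qc; exists c; rewrite ?cP // inE.
Qed.

Lemma boundary_paneP P q :
  reflect (exists2 c, c \in P /\ q \in cell_panes c &
             forall c', c' \in P -> q \in cell_panes c' -> c' = c)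
          (q \in boundary_panes P).
Proof.
apply: (iffP idP).
  rewrite !inE => /andP[_ /cardfs1P[c Ec]].
  have := fset11 c; rewrite -Ec !inE => /andP[/= cP qc]; exists c => // c' c'P qc'.
  by apply/fset1P; rewrite -Ec !inE /= c'P qc'.
case=> c [cP qc] uc; rewrite !inE /=; apply/andP; split.
  by apply/mem_region_panes; exists c.
apply/cardfs1P; exists c; apply/fsetP => c'; rewrite !inE /=.
by apply/andP/eqP => [[]|->]; [exact: uc | split].
Qed.

Lemma pairD (a b c d : int) : (a, b) + (c, d) = (a + c, b + d).
Proof. by []. Qed.

Lemma pairN (a b : int) : - (a, b) = (- a, - b).
Proof. by []. Qed.

Lemma pairMn (a b : int) n : (a, b) *+ n = (a *+ n, b *+ n).
Proof.
by elim: n => [|n IH]; rewrite ?mulr0n // !mulrSr IH pairD.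
Qed.

Definition pairE := (pairD, pairN).

Lemma beam_directionP d : d \in beam_directions ->
  [\/ d = (0, 1), d = (1, -1) | d = (-1, 0)].
Proof.
by rewrite !inE => /or3P[]/eqP->; [constructor 1|constructor 2|constructor 3].
Qed.

Lemma cell_panesP (c : cell) q : q \in cell_panes c ->
  let x := c.1.1 in let y := c.1.2 in
  if c.2 then [\/ q = (x + x + 1, y + y), q = (x + x, y + y + 1) |
                  q = (x + x + 1, y + y + 1)]
  else [\/ q = (x + x + 1, y + y + 1), q = (x + x + 2, y + y + 1) |
           q = (x + x + 1, y + y + 2)].
Proof.
case: c => -[x y] []; rewrite !inE /= => /or3P[] /eqP ->;
  [constructor 1|constructor 2|constructor 3|
   constructor 1|constructor 2|constructor 3];
  rewrite !pairE /=; congr pair; lia.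
Qed.

Lemma cell_panes_uniq_dir c q d d' : q \in cell_panes c ->
  d \in beam_directions -> d' \in beam_directions ->
  q - d \in cell_panes c -> q - d' \in cell_panes c -> d = d'.
Proof.
move=> /cell_panesP + /beam_directionP + /beam_directionP +
       /cell_panesP + /cell_panesP.
case: c q => -[x y] [] [u v] /= hq [] -> [] -> //;
  rewrite !pairE /= => h1 h2; exfalso;
  case: hq => -[? ?]; case: h1 => -[? ?]; case: h2 => -[? ?]; lia.
Qed.

Lemma cell_panes_dir_uniq c q d d' : q \in cell_panes c ->
  d \in beam_directions -> d' \in beam_directions ->
  q + d \in cell_panes c -> q + d' \in cell_panes c -> d = d'.
Proof.
move=> /cell_panesP + /beam_directionP + /beam_directionP +
       /cell_panesP + /cell_panesP.
case: c q => -[x y] [] [u v] /= hq [] -> [] -> //;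
  rewrite !pairE /= => h1 h2; exfalso;
  case: hq => -[? ?]; case: h1 => -[? ?]; case: h2 => -[? ?]; lia.
Qed.

Lemma cell_panes_dir c q : q \in cell_panes c ->
  {d | d \in beam_directions & q + d \in cell_panes c}.
Proof.
move=> qc; case E: [seq d <- beam_directions | q + d \in cell_panes c] => [|d s].
  exfalso; have: ~~ has (fun d => q + d \in cell_panes c) beam_directions.
    by rewrite has_filter E.
  case: c qc {E} => -[x y] [] /[!inE] /or3P[]/eqP->;
    rewrite /= /northeast /southeast /west /e1 /e2 !pairE !inE !xpair_eqE /=; lia.
have: d \in [seq d <- beam_directions | q + d \in cell_panes c].
  by rewrite E mem_head.
by rewrite mem_filter => /andP[? ?]; exists d.
Qed.

Lemma cell_panes_next c c' q d : d \in beam_directions ->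
  q \in cell_panes c -> q + d \in cell_panes c -> q + d \in cell_panes c' ->
  c' <> c -> q + d + d \in cell_panes c'.
Proof.
move=> /beam_directionP + /cell_panesP + /cell_panesP + /cell_panesP.
case: c c' q => -[x y] b [[x' y'] b'] [u v] /= hd hq h1 h2 ne.
have {}ne : (x == x') && (y == y') && (b == b') = false.
  by apply/negP => /andP[/andP[/eqP ex /eqP ey] /eqP eb]; apply: ne; congr (_, _, _).
case: hd h1 h2 => ->; rewrite !pairE /=;
  case: b b' hq ne => [] [] hq; rewrite ?andbT ?andbF => ne h1 h2;
  rewrite !inE ?/e1 ?/e2 ?pairE ?xpair_eqE /=;
  case: hq => -[? ?]; case: h1 => -[? ?]; case: h2 => -[? ?]; lia.
Qed.

Lemma direction_neq0 d : d \in beam_directions -> d != 0.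
Proof. by move=> /beam_directionP[] ->. Qed.

Lemma mulrn_inj_pair (d : vertex) : d != 0 -> injective (fun k : nat => d *+ k).
Proof.
case: d => a b d0 k l; rewrite !pairMn => -[ha hb].
have [a0|a0] := eqVneq a 0; last exact: mulrIn a0 _ _ ha.
have [b0|b0] := eqVneq b 0; last exact: mulrIn b0 _ _ hb.
by rewrite a0 b0 eqxx in d0.
Qed.

(* The direction is unique by cell_panes_dir_uniq, as q is a side of only one  *)
(* cell of P.                                                                  *)
Lemma entry_direction P q : q \in boundary_panes P ->
  {d | d \in beam_directions & crosses P d q}.
Proof.
move=> qb; have Pq : q \in region_panes P by move: qb; rewrite !inE => /andP[].
have [c cP qc] : {c | c \in P & q \in cell_panes c}.
  have hs : has (fun c => q \in cell_panes c) P.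
    by apply/hasP; case/mem_region_panes: Pq => c ? ?; exists c.
  exists (nth ((0, 0), true) P (find (fun c => q \in cell_panes c) P)).
    by apply: mem_nth; rewrite -has_find.
  exact: (nth_find _ hs).
by have [d dD qdc] := cell_panes_dir qc; exists d => //; exists c; rewrite ?qc.
Qed.

Lemma beam_continues P q d : d \in beam_directions -> crosses P d q ->
  q + d \notin boundary_panes P -> crosses P d (q + d).
Proof.
move=> dD [c cP /andP[qc qdc]] nb.
have [c' /and3P[c'P c'c qdc']] : exists c', [&& c' \in P, c' != c & q + d \in cell_panes c'].
  have [/hasP[c' c'P /andP[? ?]]|/hasPn no] :=
    boolP (has (fun c' => (c' != c) && (q + d \in cell_panes c')) P).
    by exists c'; apply/and3P.
  case/negP: nb; apply/boundary_paneP; exists c => // c' c'P qdc'.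
  by apply/eqP; have := no _ c'P; rewrite qdc' andbT negbK.
exists c' => //; rewrite qdc' /=; apply: cell_panes_next qdc' _ => //; first exact: qc.
  by [].
by apply/eqP.
Qed.

Lemma beam_exists P q : q \in boundary_panes P -> {r | beam P q r}.
Proof.
move=> qb; have [d dD cr] := entry_direction qb.
have cross k : (forall i, (0 < i <= k)%N -> q + d *+ i \notin boundary_panes P) ->
    crosses P d (q + d *+ k).
  elim: k => [|k IH] nb; first by rewrite addr0.
  rewrite mulrSr addrA; apply: beam_continues => //.
    by apply: IH => i /andP[i0 ik]; apply: nb; rewrite i0 leqW.
  by rewrite -addrA -mulrSr; apply: nb; rewrite leqnn.
have ex : exists k, (0 < k)%N && (q + d *+ k \in boundary_panes P).
  pose N := size (region_panes P).
  have [/hasP[k]|/hasPn no] :=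
    boolP (has (fun k => q + d *+ k \in boundary_panes P) (iota 1 N)).
    by rewrite mem_iota => /andP[k0 _] kb; exists k; rewrite k0.
  suff : (N.+1 <= N)%N by rewrite ltnn.
  rewrite -[X in (X <= _)%N](size_iota 0) -(size_map (fun k => q + d *+ k)).
  apply: uniq_leq_size => [|r /mapP[k]].
    rewrite map_inj_uniq ?iota_uniq // => k l /addrI.
    exact/mulrn_inj_pair/direction_neq0.
  rewrite mem_iota add0n ltnS => kN ->.
  have [|c cP /andP[qc _]] := cross k.
    by move=> i /andP[i0 ik]; apply: no; rewrite mem_iota i0 ltnS (leq_trans ik).
  by apply/mem_region_panes; exists c.
have min := ex_minnP ex; exists (q + d *+ ex_minn ex); exists d => //.
exists (ex_minn ex); case: min => k /andP[k0 kb] kmin; split=> // i.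
  move=> ik; apply: cross => j /andP[j0 ji]; apply/negP => jb.
  by have := kmin j; rewrite j0 jb leqNgt (leq_ltn_trans ji ik) => /(_ isT).
move=> /andP[i0 ik]; apply/negP => ib.
by have := kmin i; rewrite i0 ib leqNgt ik => /(_ isT).
Qed.

Lemma beam_functional P q r r' :
  q \in boundary_panes P -> beam P q r -> beam P q r' -> r = r'.
Proof.
move=> /boundary_paneP[c [cP qc] uc].
have entry d k : (0 < k)%N -> (forall i, (i < k)%N -> crosses P d (q + d *+ i)) ->
    q + d \in cell_panes c.
  move=> k0 /(_ 0%N k0)[c' c'P]; rewrite addr0 => /andP[qc' ?].
  by rewrite -(uc c').
case=> d dD [k [k0 cr nb -> rb]] [d' d'D [k' [k'0 cr' nb' -> rb']]].
have dd : d = d'.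
  exact: (cell_panes_dir_uniq qc dD d'D (entry _ _ k0 cr) (entry _ _ k'0 cr')).
rewrite -{}dd in nb' rb' *; have [kk|kk|-> //] := ltngtP k k'.
  by have := nb' k; rewrite k0 kk rb => /(_ isT).
by have := nb k'; rewrite k'0 kk rb' => /(_ isT).
Qed.

Lemma beam_injective P q q' r : q \in boundary_panes P ->
  q' \in boundary_panes P -> beam P q r -> beam P q' r -> q = q'.
Proof.
move=> qb q'b [d dD [k [k0 cr nb rE rb]]] [d' d'D [k' [k'0 cr' nb' r'E _]]].
have [c [cP rc] uc] := boundary_paneP _ _ rb.
have exit e p l : (0 < l)%N -> (forall i, (i < l)%N -> crosses P e (p + e *+ i)) ->
    r = p + e *+ l -> r - e \in cell_panes c.
  case: l => // l _ /(_ l (ltnSn l))[c' c'P /andP[pc' pec']] rpe.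
  have rE' : r = p + e *+ l + e by rewrite rpe mulrSr addrA.
  by rewrite rE' addrK -(uc c') // rE'.
have dd : d = d'.
  exact: (cell_panes_uniq_dir rc dD d'D (exit _ _ _ k0 cr rE)
                                        (exit _ _ _ k'0 cr' r'E)).
rewrite -{}dd in r'E nb'.
have qE : q = r - d *+ k by rewrite rE addrK.
have q'E : q' = r - d *+ k' by rewrite r'E addrK.
have [kk|kk|kk] := ltngtP k k'; last by rewrite qE q'E kk.
  have := nb' (k' - k)%N; rewrite subn_gt0 kk ltn_subrL k0 k'0 => /(_ isT)/negP[].
  by rewrite q'E mulrnBr ?(ltnW kk) // addrA subrK -qE.
have := nb (k - k')%N; rewrite subn_gt0 kk ltn_subrL k0 k'0 => /(_ isT)/negP[].
by rewrite qE mulrnBr ?(ltnW kk) // addrA subrK -q'E.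
Qed.

Lemma mem_panes (P : grid_polygon) : panes P =i boundary_panes P.
Proof. by case: P => P s [? ? ? sE ?]; apply: sE. Qed.

Lemma third_vertex (v w v' w' : vertex) : v + w = v' + w' ->
  v + cw60 (w - v) = v' + cw60 (w' - v') -> v = v'.
Proof.
case: v w v' w' => [a b] [c d] [a' b'] [c' d']; rewrite /cw60 !pairE /=.
by move=> [? ?] [? ?]; congr pair; lia.
Qed.

Lemma cell_vertices_sum c v w u : perm_eq (cell_vertices c) [:: v; w; u] ->
  \sum_(x <- cell_vertices c) x = v + w + u.
Proof.
move=> /(perm_big _)->; rewrite !big_cons big_nil.
by rewrite -[LHS]/(v + (w + (u + 0))) addr0 addrA.
Qed.

Lemma cell_panes_pair c v w u : perm_eq (cell_vertices c) [:: v; w; u] ->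
  v + w \in cell_panes c.
Proof.
move=> pc; have uc : u \in cell_vertices c.
  by rewrite (perm_mem pc) !inE eqxx !orbT.
have -> : v + w = \sum_(x <- cell_vertices c) x - u.
  by rewrite (cell_vertices_sum pc) addrK.
case: c uc {pc} => -[x y] [] /=; rewrite !big_cons big_nil !inE /e1 /e2 !pairE;
  move=> /or3P[]/eqP->; rewrite !xpair_eqE /=; lia.
Qed.

Lemma panes_uniq (P : grid_polygon) : uniq (panes P).
Proof.
case: P => P s [s2 us sa sE scw]; rewrite map_inj_in_uniq // => v v' vs v's E.
have [c cP pc] := scw v vs; have [c' c'P pc'] := scw v' v's.
have /boundary_paneP[c0 _ uc] : v + next s v \in boundary_panes P.
  by rewrite -sE; apply: map_f.
have cc : c = c'.
  rewrite (uc c) ?(cell_panes_pair pc) //.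
  by rewrite (uc c') // E (cell_panes_pair pc').
apply: third_vertex (E) _.
have := cell_vertices_sum pc; rewrite cc (cell_vertices_sum pc') E.
by move=> /addrI.
Qed.

Fact billiards_subproof (P : grid_polygon) (i : 'I_(size (panes P))) :
  {j : 'I_(size (panes P)) | beam P (panes P)`_i (panes P)`_j}.
Proof.
have ib : (panes P)`_i \in boundary_panes P by rewrite -mem_panes mem_nth.
have [r br] := beam_exists ib.
have rb : r \in panes P by rewrite mem_panes; case: br => d _ [k []].
have rlt : (index r (panes P) < size (panes P))%N by rewrite index_mem.
by exists (Ordinal rlt); rewrite /= nth_index.
Qed.

Definition billiards_fun (P : grid_polygon) (i : 'I_(size (panes P))) :=
  sval (billiards_subproof i).

Fact billiards_fun_inj (P : grid_polygon) : injective (@billiards_fun P).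
Proof.
move=> i i' ii; apply/val_inj/eqP.
rewrite -(nth_uniq 0 (ltn_ord i) (ltn_ord i') (panes_uniq P)); apply/eqP.
have bi := svalP (billiards_subproof i); have bi' := svalP (billiards_subproof i').
rewrite -!/(billiards_fun _) -ii in bi bi'.
by apply: beam_injective bi bi'; rewrite -mem_panes mem_nth.
Qed.

Definition billiards (P : grid_polygon) : {perm 'I_(size (panes P))} :=
  perm (@billiards_fun_inj P).

(* The values of billiards are thus determined by the relation beam. *)
Lemma billiardsP (P : grid_polygon) (i j : 'I_(size (panes P))) :
  billiards P i = j <-> beam P (panes P)`_i (panes P)`_j.
Proof.
have bi := svalP (billiards_subproof i); rewrite -/(billiards_fun i) in bi.
rewrite permE; split=> [<- //|bij]; apply/val_inj/eqP.
rewrite -(nth_uniq 0 (ltn_ord _) (ltn_ord j) (panes_uniq P)); apply/eqP.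
by apply: beam_functional bi bij; rewrite -mem_panes mem_nth.
Qed.

Definition cyc (P : grid_polygon) : nat := #|porbits (billiards P)|.

(* The unit hexagon centred at the vertex v consists of the six cells that     *)
(* have v as a vertex.                                                         *)
Definition unit_hexagon (v : vertex) : {fset cell} :=
  [fset c in [:: (v, true); (v - e1, true); (v - e2, true);
                 (v - e1, false); (v - e2, false); (v - e1 - e2, false)]].

Lemma in_unit_hexagon v c : (c \in unit_hexagon v) = (v \in cell_vertices c).
Proof.
have vE x u : (x == v - u) = (v == x + u) by rewrite eq_sym subr_eq.
case: c => x up; rewrite /unit_hexagon -[v - e1 - e2]addrA -opprD.
rewrite !inE ![(x, up) == _]xpair_eqE (vE _ e1) (vE _ e2) (vE _ (e1 + e2)).
rewrite (eq_sym x).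
case: up; rewrite /= !inE.
  by rewrite !andbT !andbF !orbF.
by rewrite !andbT !andbF /= orbF (addrA x).
Qed.

(* The intersection of the closed regions P and Q is a single pane: the only   *)
(* grid vertices, panes and cells contained in both are that pane and its two  *)
(* endpoints v and w.                                                          *)
Definition meet_in_single_pane (P Q : {fset cell}) : Prop :=
  exists v w, [/\ adjacent v w,
    region_vertices P `&` region_vertices Q = [fset v; w],
    region_panes P `&` region_panes Q = [fset v + w] &
    P `&` Q = fset0].

Inductive tree_of_unit_hexagons : {fset cell} -> Prop :=
| TreeHexagon v : tree_of_unit_hexagons (unit_hexagon v)
| TreeAttach P v :
    tree_of_unit_hexagons P -> meet_in_single_pane P (unit_hexagon v) ->
    tree_of_unit_hexagons (P `|` unit_hexagon v).

(* Main.v *)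
(* Assign a number to every trajectory, and let x be the sum over trajectories *)
(* of this number times the winding number about a vertex.  Then x vanishes on *)
(* the boundary of P, the numbers are recovered from x up to a common constant,*)
(* and around every interior vertex u the alternating sum of the values of x   *)
(* at the six neighbours of u is zero.  For each of the six unit vectors d, the*)
(* equation at u expresses x (u + d) through values of x at vertices which are *)
(* less far in direction d, so x is determined by its values on the set S_d of *)
(* the interior vertices v with v - d not interior: cyc P - 1 <= #|S_d|.       *)
(* Summing over d, and sending a pair (v, d) with v interior and v + d not     *)
(* interior to the cell on the left of the step from v to v + d, which is an   *)
(* injection, gives 6 (cyc P - 1) <= area P.                                   *)
(*   In case of equality every cell has one or two interior vertices.  If two  *)
(* interior vertices were adjacent, one more equation could be used in the     *)
(* elimination, so every cell has exactly one interior vertex, and P is a      *)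
(* disjoint union of unit hexagons.  They form a tree, because a pane common   *)
(* to two of them has both ends on the boundary of P and so separates P.       *)
(* Conversely, attaching a hexagon along a pane to a tree of k hexagons adds   *)
(* at least one trajectory, so cyc P >= k + 1 = area P / 6 + 1.                *)

Require Import Defs.
From mathcomp Require Import all_boot all_order all_algebra finmap.
From mathcomp Require Import perm zify lra.

Set Implicit Arguments.
Unset Strict Implicit.
Unset Printing Implicit Defensive.

Import Order.TTheory GRing.Theory Num.Theory.

Local Open Scope fset_scope.
Local Open Scope ring_scope.

(** The billiards permutation is studied through [light_invariant] functions: functions on beam
    segments that are constant along trajectories. [cyc_classes] presents the cycles as the values
    of one such function, and [trajectory_universal] says that every other one factors through them.

    Upper bound: the [potential] of an invariant vanishes on the boundary curve
    ([potential_boundary]), determines the invariant up to a constant because [P] is connected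
    ([light_constant]), and satisfies one linear relation per interior vertex ([interior_equation]).
    Elimination in one direction gives [light_classes_dir]; summing over the six directions gives
    [light_classes_area]. Equality forces the interior vertices to be isolated and every cell to
    touch one ([light_classes_extremal]); [hexagons_tree] then assembles the hexagons, using
    [bridge] to exclude a second common pane.

    Lower bound: on a tree of [k] hexagons a Boolean invariant can be prescribed freely on [k + 1]
    segments ([tree_flags]), which therefore lie on different cycles ([flags_cyc]). With the upper
    bound this gives equality. *)

Ltac destruct_vertices :=
  repeat match goal with v : (int * int)%type |- _ => destruct v end.
Ltac vertex_eq := destruct_vertices; rewrite /e1 /e2 ?pairE /=; congr pair; lia.

(** * Cells around a vertex *)

Definition ccw60 (d : vertex) : vertex := (- d.2, d.1 + d.2).

Definition units : seq vertex := [:: e1; e2; e2 - e1; - e1; - e2; e1 - e2].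

Lemma unitsP d : d \in units ->
  d = (1, 0) \/ d = (0, 1) \/ d = (-1, 1) \/ d = (-1, 0) \/ d = (0, -1) \/
  d = (1, -1).
Proof. by rewrite !inE => /orP[|/orP[|/orP[|/orP[|/orP[|]]]]] /eqP ->; tauto. Qed.

Ltac unit_cases h :=
  move/unitsP: h; do 5 ?[case=> [->|]]; try (move=> ->).

Lemma ccw60_unit d : d \in units -> ccw60 d \in units.
Proof. by move=> h; unit_cases h. Qed.

Lemma opp_unit d : d \in units -> - d \in units.
Proof. by move=> h; unit_cases h. Qed.

(* The grid cell to the left of the step from v to v + d. *)
Definition corner (v d : vertex) : cell :=
  if d == e1 then (v, true) else if d == e2 then (v - e1, false) else
  if d == e2 - e1 then (v - e1, true) else
  if d == - e1 then (v - e1 - e2, false) else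
  if d == - e2 then (v - e2, true) else (v - e2, false).

Lemma cell_verticesE c : cell_vertices c =
  if c.2 then [:: c.1; c.1 + e1; c.1 + e2]
  else [:: c.1 + e1; c.1 + e2; c.1 + e1 + e2].
Proof. by case: c => v []. Qed.

Lemma corner_vertices v d : d \in units ->
  cell_vertices (corner v d) =i [:: v; v + d; v + ccw60 d].
Proof.
move=> h [a b]; rewrite cell_verticesE; case: v => x y.
by unit_cases h; rewrite /corner /ccw60 /e1 /e2 !pairE /= !inE !xpair_eqE /=; lia.
Qed.

Lemma cell_vertices_inj c c' :
  {subset cell_vertices c <= cell_vertices c'} -> c = c'.
Proof.
case: c c' => [[x y] b] [[x' y'] b'] sub.
have: all [in cell_vertices (x', y', b')] (cell_vertices (x, y, b)) by exact/allP.
rewrite !cell_verticesE; case: b b' {sub} => [] [];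
  rewrite /= !inE !pairE !xpair_eqE /= => H; first [congr (_, _, _); lia | exfalso; lia].
Qed.

Lemma corner_of_vertex v c : v \in cell_vertices c ->
  exists2 d, d \in units & c = corner v d.
Proof.
case: c v => [[x y] b] [u v]; rewrite cell_verticesE; case: b => /=;
  rewrite !inE => /or3P[] /eqP[-> ->];
  [exists (1, 0)|exists (-1, 1)|exists (0, -1)
  |exists (0, 1)|exists (1, -1)|exists (-1, 0)] => //;
  rewrite /corner /e1 /e2 !pairE /= ?pairE; congr (_, _, _); lia.
Qed.

Lemma mem_cell_panes v w c : adjacent v w ->
  (v + w \in cell_panes c) = (v \in cell_vertices c) && (w \in cell_vertices c).
Proof.
move=> vw; have -> : w = v + (w - v) by rewrite addrC subrK.
move: (w - v) (vw : w - v \in units) => d {vw w} h.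
case: c v => [[x y] b] [u v]; rewrite cell_verticesE.
by unit_cases h; case: b; rewrite /= !pairE !inE !xpair_eqE /=; lia.
Qed.

Lemma cell_pane_ends c q : q \in cell_panes c ->
  exists v w, [/\ adjacent v w, q = v + w, v \in cell_vertices c &
                  w \in cell_vertices c].
Proof.
case: c => [v b]; case: b; rewrite !inE => /or3P[] /eqP->;
  [exists v, (v + e1)|exists v, (v + e2)|exists (v + e1), (v + e2)
  |exists (v + e1), (v + e2)|exists (v + e1), (v + e1 + e2)
  |exists (v + e2), (v + e1 + e2)]; split=> //;
  rewrite ?cell_verticesE ?inE ?eqxx ?orbT //;
  case: v => x y; rewrite /adjacent !pairE /= !inE !xpair_eqE /=; lia.
Qed.

Lemma pane_ends v w v' w' : adjacent v w -> adjacent v' w' -> v + w = v' + w' ->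
  (v = v' /\ w = w') \/ (v = w' /\ w = v').
Proof.
move=> vw; have -> : w = v + (w - v) by rewrite addrC subrK.
move: (w - v) (vw : w - v \in units) => d {vw w} h.
move=> vw; have -> : w' = v' + (w' - v') by rewrite addrC subrK.
move: (w' - v') (vw : w' - v' \in units) => d' {vw w'} h'.
case: v v' => [x y] [x' y'].
unit_cases h; unit_cases h'; rewrite !pairE /= => -[? ?];
  first [left; split; congr pair; lia | right; split; congr pair; lia | exfalso; lia].
Qed.

Lemma adjacent_unit v d : d \in units -> adjacent v (v + d).
Proof. by rewrite /adjacent addrAC subrr add0r. Qed.

Lemma cw60K : cancel cw60 ccw60.
Proof. by case=> a b; rewrite /cw60 /ccw60 /=; congr pair; lia. Qed.

Lemma ccw60K : cancel ccw60 cw60.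
Proof. by case=> a b; rewrite /cw60 /ccw60 /=; congr pair; lia. Qed.

Lemma cw60_unit d : d \in units -> cw60 d \in units.
Proof. by move=> h; unit_cases h. Qed.

Lemma pane_corners v d c : d \in units ->
  (v + (v + d) \in cell_panes c) = (c == corner v d) || (c == corner v (cw60 d)).
Proof.
case: c v => [[x y] b] [u v] h.
by unit_cases h; case: b; rewrite /corner /cw60 /e1 /e2 /= ?pairE /= !inE !xpair_eqE /=; lia.
Qed.

Lemma corner_cw60_neq v d : d \in units -> corner v (cw60 d) != corner v d.
Proof.
case: v => [u v] h.
by unit_cases h; rewrite /corner /cw60 /e1 /e2 ?pairE /= ?pairE /= !xpair_eqE /=; lia.
Qed.

Lemma boundary_corners P v d : d \in units ->
  (v + (v + d) \in boundary_panes P)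
  = (corner v d \in P) (+) (corner v (cw60 d) \in P).
Proof.
move=> h; apply/boundary_paneP/idP => [[c []]|].
  rewrite pane_corners // => cP /orP[]/eqP cE uc; subst c; rewrite cP.
    apply/negP => cP'; case/negP: (corner_cw60_neq v h); apply/eqP/uc => //.
    by rewrite pane_corners // eqxx orbT.
  rewrite addbT; apply/negP => cP'; case/negP: (corner_cw60_neq v h).
  by apply/eqP/esym/uc => //; rewrite pane_corners // eqxx.
have [cP /= ncP|ncP /= cP] := boolP (corner v d \in P).
  exists (corner v d); first by rewrite pane_corners ?eqxx.
  move=> c cP'; rewrite pane_corners // => /orP[]/eqP // cE.
  by rewrite cE (negPf ncP) in cP'.
exists (corner v (cw60 d)); first by rewrite pane_corners ?eqxx ?orbT.
move=> c cP'; rewrite pane_corners // => /orP[]/eqP // cE.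
by rewrite cE (negPf ncP) in cP'.
Qed.

Lemma ccw60_invariant (T : Type) (f : vertex -> T) :
  {in units, forall d, f (ccw60 d) = f d} ->
  {in units &, forall d d', f d = f d'}.
Proof.
move=> fE; have E d : d \in units -> f d = f (1, 0).
  have E1 : f (0, 1) = f (1, 0) by rewrite -[RHS]fE.
  have E2 : f (-1, 1) = f (1, 0) by rewrite -E1 -[RHS]fE.
  have E3 : f (-1, 0) = f (1, 0) by rewrite -E2 -[RHS]fE.
  have E4 : f (0, -1) = f (1, 0) by rewrite -E3 -[RHS]fE.
  have E5 : f (1, -1) = f (1, 0) by rewrite -E4 -[RHS]fE.
  by move=> h; unit_cases h.
by move=> d d' dU d'U; rewrite E // E.
Qed.

(** * The boundary curve and connectedness *)

Lemma boundary_pane_vertices P s v w : clockwise_boundary P s -> adjacent v w ->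
  v + w \in boundary_panes P -> v \in s /\ w = next s v \/ w \in s /\ v = next s w.
Proof.
move=> [_ _ ca sE _] vw; rewrite -sE => /mapP[u us E].
have uu : adjacent u (next s u) by exact: next_cycle.
by have [[-> ->]|[-> ->]] := pane_ends vw uu E; [left|right].
Qed.

Lemma boundary_pane_in P s v w : clockwise_boundary P s -> adjacent v w ->
  v + w \in boundary_panes P -> v \in s.
Proof.
move=> cb vw vwb; have [[] //|[ws E]] := boundary_pane_vertices cb vw vwb.
by rewrite [v]E mem_next.
Qed.

(** No boundary pane ends at a vertex off the curve, so membership in [P] cannot change while
    turning about it. *)
Lemma cells_around P s v c c' : clockwise_boundary P s -> v \notin s ->
  v \in cell_vertices c -> v \in cell_vertices c' -> (c \in P) = (c' \in P).
Proof.
move=> cb vs /corner_of_vertex[d dU ->] /corner_of_vertex[d' d'U ->].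
apply: (ccw60_invariant (f := fun d => corner v d \in P)) => // {d' d'U}{}d {}dU.
have dU' := ccw60_unit dU; have := boundary_corners P v dU'; rewrite ccw60K.
have /negbTE-> : v + (v + ccw60 d) \notin boundary_panes P.
  by apply: contra vs; apply: (boundary_pane_in cb (adjacent_unit v dU')).
by case: (_ \in P); case: (_ \in P).
Qed.

Lemma boundary_step P s v : clockwise_boundary P s -> v \in s ->
  [/\ next s v - v \in units, corner v (cw60 (next s v - v)) \in P
    & corner v (next s v - v) \notin P].
Proof.
move=> [_ _ ca sE right] vs; have dU : next s v - v \in units := next_cycle ca vs.
have vd : v + (next s v - v) = next s v by rewrite addrC subrK.
have [c cP pc] := right _ vs; have cE : corner v (cw60 (next s v - v)) = c.
  apply: cell_vertices_inj => u; rewrite corner_vertices ?cw60_unit // cw60K vd.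
  by rewrite (perm_mem pc) !inE => /or3P[] ->; rewrite ?orbT.
split=> //; first by rewrite cE.
have : v + (v + (next s v - v)) \in boundary_panes P by rewrite vd -sE; apply/mapP; exists v.
by rewrite boundary_corners // cE cP addbT.
Qed.

(** Simplicity of the curve enters here: as [s] has no repetition, at most two boundary panes end at
    a vertex. *)
Lemma boundary_degree P s v d : clockwise_boundary P s -> d \in units ->
  v + (v + d) \in boundary_panes P -> v + d = next s v \/ v + d = prev s v.
Proof.
move=> cb dU /(boundary_pane_vertices cb (adjacent_unit v dU))[[_ ->]|[ws vE]].
  by left.
by right; case: cb => [_ us _ _ _]; rewrite [in RHS]vE prev_next.
Qed.

Lemma mem_pane_e1 (v : vertex) c :
  (v + (v + e1) \in cell_panes c) = (c == (v, true)) || (c == (v - e2, false)).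
Proof. by rewrite pane_corners. Qed.

Lemma mem_pane_e2 (v : vertex) c :
  (v + (v + e2) \in cell_panes c) = (c == (v, true)) || (c == (v - e1, false)).
Proof. by rewrite pane_corners // orbC. Qed.

Lemma mem_pane_e12 (v : vertex) c :
  ((v + e1) + (v + e2) \in cell_panes c) = (c == (v, true)) || (c == (v, false)).
Proof.
have -> : v + e2 = (v + e1) + (e2 - e1) by vertex_eq.
by rewrite pane_corners // /corner /= addrK.
Qed.

Lemma boundary_e1 P (v : vertex) : (v + (v + e1) \in boundary_panes P)
  = ((v, true) \in P) (+) ((v - e2, false) \in P).
Proof. by rewrite boundary_corners. Qed.

Lemma boundary_e2 P (v : vertex) : (v + (v + e2) \in boundary_panes P)
  = ((v, true) \in P) (+) ((v - e1, false) \in P).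
Proof. by rewrite boundary_corners // addbC. Qed.

Lemma boundary_e12 P (v : vertex) : ((v + e1) + (v + e2) \in boundary_panes P)
  = ((v, true) \in P) (+) ((v, false) \in P).
Proof.
have -> : v + e2 = (v + e1) + (e2 - e1) by vertex_eq.
by rewrite boundary_corners // /corner /= addrK.
Qed.

(** * Connectedness of a polygon through shared panes *)

Definition neighbors (c c' : cell) : Prop :=
  exists2 q, q \in cell_panes c & q \in cell_panes c'.

Inductive linked (P : {fset cell}) : cell -> cell -> Prop :=
| linked_refl c : linked P c c
| linked_step c c' c'' :
    c \in P -> c' \in P -> neighbors c c' -> linked P c' c'' -> linked P c c''.

Lemma linked1 P c c' : c \in P -> c' \in P -> neighbors c c' -> linked P c c'.
Proof. by move=> cP c'P cc'; apply: linked_step cc' (linked_refl _ _). Qed.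

Lemma linked_trans P c c' c'' : linked P c c' -> linked P c' c'' -> linked P c c''.
Proof. by elim=> // {}c x y cP xP cx _ IH /IH; apply: linked_step. Qed.

Lemma linked_sym P c c' : linked P c c' -> linked P c' c.
Proof.
elim=> [{}c|{}c x y cP xP [q qc qx] _ IH]; first exact: linked_refl.
by apply: linked_trans IH (linked1 _ _ _) => //; exists q.
Qed.

Lemma linked_sub (P Q : {fset cell}) c c' : P `<=` Q -> linked P c c' -> linked Q c c'.
Proof.
move=> /fsubsetP PQ; elim=> [{}c|{}c x y cP xP cx _ IH]; first exact: linked_refl.
exact: linked_step (PQ _ cP) (PQ _ xP) cx IH.
Qed.

Lemma next_ind s (Q : vertex -> Prop) v w : uniq s -> v \in s -> w \in s ->
  {in s, forall u, Q u -> Q (next s u)} -> Q v -> Q w.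
Proof.
move=> us vs ws step Qv.
have [k ->] : exists k, w = iter k (next s) v.
  have [i s' rotE] := rot_to vs.
  have ur : uniq (v :: s') by rewrite -rotE rot_uniq.
  have : fcycle (next s) (v :: s') by rewrite -rotE rot_cycle cycle_next.
  move=> /fpathP[n nE]; have : w \in v :: rcons s' v.
    by move: ws; rewrite -(mem_rot i) rotE !inE mem_rcons inE orbA orbb.
  by rewrite nE -[_ :: _]/(traject _ _ n.+1) => /trajectP[k _ ->]; exists k.
elim: k => //= k; apply: step.
by elim: k => //= k IH; rewrite mem_next.
Qed.

Definition right_cell s v := corner v (cw60 (next s v - v)).

Lemma corner_shift v d : d \in units -> corner (v + d) (cw60 (- d)) = corner v d.
Proof.
case: v => [x y] h.
by unit_cases h; rewrite /corner /cw60 /e1 /e2 ?pairE /= ?pairE /=; congr (_, _, _); lia.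
Qed.

Lemma corner_shift' v d : d \in units -> corner (v + d) (- d) = corner v (cw60 d).
Proof.
case: v => [x y] h.
by unit_cases h; rewrite /corner /cw60 /e1 /e2 ?pairE /= ?pairE /=; congr (_, _, _); lia.
Qed.

Lemma iter_ccw60_neq d k : d \in units -> iter k.+1 ccw60 d = d -> ~ (k < 5)%N.
Proof. by move=> h; unit_cases h; case: k => [|[|[|[|[|k]]]]]. Qed.

(** Turning about the common vertex of two consecutive steps, from the incoming pane to the outgoing
    one, stays in [P]: leaving it would cross a third boundary pane, against [boundary_degree]. *)
Lemma right_cell_next P s u : clockwise_boundary P s -> u \in s ->
  linked P (right_cell s u) (right_cell s (next s u)).
Proof.
move=> cb us; have [dU rP nP] := boundary_step cb us.
have vs : next s u \in s by rewrite mem_next.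
move: rP nP; rewrite /right_cell; set v := next s u in dU vs *.
have [aU raP naP] := boundary_step cb vs; move: raP.
set a := next s v - v in aU naP *; set b := u - v.
have bU : b \in units by rewrite /b -opprB opp_unit.
have -> : v - u = - b by rewrite opprB.
have uE : u = v + b by rewrite addrC subrK.
rewrite uE corner_shift // corner_shift' // => raP rP nP.
have ab : a != b by apply: contraNneq nP => <-.
have ex : exists m, (m < 5)%N && (iter m.+1 ccw60 b == a).
  move: aU bU ab => h h'; clear -h h'; move: a b h h' => {}a {}b h h'.
  by unit_cases h; unit_cases h' => // _;
    first [by exists 0%N|by exists 1%N|by exists 2%N|by exists 3%N|by exists 4%N].
case: (ex_minnP ex) => m /andP[m5 /eqP mE] mmin.
have DU k : iter k ccw60 b \in units by elim: k => //= k; apply: ccw60_unit.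
have -> : cw60 a = iter m ccw60 b by rewrite -mE /= ccw60K.
have {ex mE} m5' : (m < 6)%N by exact: ltnW.
suff /(_ m (leqnn m))[] : forall k, (k <= m)%N -> corner v (iter k ccw60 b) \in P /\
    linked P (corner v b) (corner v (iter k ccw60 b)) by [].
elim=> [_|k IH km] /=; first by split=> //; apply: linked_refl.
have [kP lk] := IH (ltnW km); have k1P : corner v (ccw60 (iter k ccw60 b)) \in P.
  apply/negPn/negP => nkP; have := boundary_corners P v (DU k.+1).
  rewrite /= ccw60K kP (negPf nkP) /= => /(boundary_degree cb (DU k.+1))[] /= E.
    suff mk : (m <= k)%N by move: km; rewrite ltnNge mk.
    by apply: mmin; rewrite (leq_trans km (ltnW m5)) /= /a -E addrC addKr.
  have pv : prev s v = u by case: cb => _ us' _ _ _; apply: prev_next.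
  by move: E; rewrite pv uE => /addrI => /(iter_ccw60_neq bU)[]; apply: leq_trans km (ltnW m5).
split=> //; apply: linked_trans lk (linked1 kP k1P _).
exists (v + (v + ccw60 (iter k ccw60 b))); rewrite pane_corners ?(DU k.+1) //.
  by rewrite ccw60K eqxx orbT.
by rewrite eqxx.
Qed.

Lemma boundary_right_cell P s v w c : clockwise_boundary P s -> adjacent v w ->
  v + w \in boundary_panes P -> c \in P -> v + w \in cell_panes c ->
  exists2 u, u \in s & c = right_cell s u.
Proof.
move=> cb vw vwb cP vwc; have /boundary_paneP[c0 _ uc] := vwb.
have R u : u \in s -> v + w = u + next s u -> c = right_cell s u.
  move=> us E; have [dU rP _] := boundary_step cb us.
  rewrite (uc _ cP vwc) [RHS]uc // E -[next s u](subrK u) [_ - _ + _]addrC.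
  by rewrite pane_corners // eqxx orbT.
have [[us E]|[us E]] := boundary_pane_vertices cb vw vwb.
  by exists v => //; apply: R => //; rewrite E.
by exists w => //; apply: R => //; rewrite -E addrC.
Qed.

Lemma seq_maximum (T : eqType) (f : T -> int) (s : seq T) : s != [::] ->
  exists2 x, x \in s & {in s, forall y, f y <= f x}.
Proof.
elim: s => // x [|y s] IH _; first by exists x; rewrite ?mem_head // => z /[!inE]/eqP->.
have [//|z zs zmax] := IH; have [xz|zx] := lerP (f x) (f z).
  exists z; first by rewrite inE zs orbT.
  by move=> t; rewrite inE => /orP[/eqP->|/zmax].
exists x; first exact: mem_head.
move=> t; rewrite inE => /orP[/eqP-> //|/zmax tz]; exact: le_trans tz (ltW zx).
Qed.

Lemma boundary_nonempty P s : clockwise_boundary P s -> s != [::].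
Proof. by case; case: s. Qed.

(** If a cell reached further, take a cell [c] of [P] with the largest first coordinate: [c.1 + e1]
    would be off the curve, and [cells_around] would put a cell with a larger coordinate into [P].
    The vertex found is the base point of all potentials. *)
Lemma rightmost_boundary P s : clockwise_boundary P s ->
  exists2 v, v \in s & {in P, forall c : cell, c.1.1 < v.1}.
Proof.
move=> cb; have [v vs vmax] := seq_maximum (fun v : vertex => v.1) (boundary_nonempty cb).
exists v => // c0 c0P; rewrite ltNge; apply/negP => c0v.
have [|c cP cmax] := @seq_maximum _ (fun c : cell => c.1.1) P.
  by apply: contraTneq c0P => E; rewrite -[_ \in _]/(c0 \in (P : seq cell)) E.
have cv := le_trans c0v (cmax _ c0P); have ws : c.1 + e1 \notin s.
  by apply/negP => /vmax; case: (c) cv => [[x y] b] /=; lia.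
have : (c.1 + e1, true) \in P.
  rewrite -(cells_around cb ws _ _ (c := c)) //; rewrite cell_verticesE ?mem_head //.
  by case: ifP; rewrite !inE eqxx ?orbT.
by move=> /cmax; case: (c) => [[x y] b] /=; lia.
Qed.

Lemma linked_right_cell P s c : clockwise_boundary P s -> c \in P ->
  exists2 v, v \in s & linked P c (right_cell s v).
Proof.
move=> cb; have [v0 _ v0max] := rightmost_boundary cb.
(* The walk follows the strip of cells in direction [e1], an upward cell and then the downward one
   for each value of the coordinate; every move lowers this measure by 1. *)
have [n] : exists n : nat, 2 * (v0.1 - c.1.1) + c.2%:Z <= n%:Z.
  by exists (absz (2 * (v0.1 - c.1.1) + c.2%:Z)); lia.
elim: n c => [|n IH] c.
  by move=> cn /v0max; case: c cn => [[x y] []] /=; lia.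
case: c => [v b] cn cP.
case: b => /= in cn cP *.
  have [c'P|nc'P] := boolP ((v, false) \in P).
    have [|w ws lw] := IH _ _ c'P; first by move: cn => /=; lia.
    exists w => //; apply: linked_trans lw; apply: linked1 => //.
    by exists ((v + e1) + (v + e2)); rewrite mem_pane_e12 eqxx ?orbT.
  have [|||u us ->] := boundary_right_cell (v := v + e1) (w := v + e2) cb _ _ cP.
  - by rewrite /adjacent (_ : _ - _ = e2 - e1) //; vertex_eq.
  - by rewrite boundary_e12 cP (negPf nc'P).
  - by rewrite mem_pane_e12 eqxx.
  by exists u => //; apply: linked_refl.
have [c'P|nc'P] := boolP ((v + e1, true) \in P).
  have [|w ws lw] := IH _ _ c'P; first by case: (v) cn => x y /=; lia.
  exists w => //; apply: linked_trans lw; apply: linked1 => //.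
  by exists ((v + e1) + (v + e1 + e2)); rewrite mem_pane_e2 addrK eqxx ?orbT.
have [|||u us ->] := boundary_right_cell (v := v + e1) (w := v + e1 + e2) cb _ _ cP.
- exact: adjacent_unit.
- by rewrite boundary_e2 addrK cP (negPf nc'P).
- by rewrite mem_pane_e2 addrK eqxx orbT.
by exists u => //; apply: linked_refl.
Qed.

(** Every cell is linked to the curve, and the cells along its right side are linked to each other,
    as the boundary is a single cycle. *)
Lemma linked_cells P s c c' : clockwise_boundary P s -> c \in P -> c' \in P ->
  linked P c c'.
Proof.
move=> cb /(linked_right_cell cb)[v vs lv] /(linked_right_cell cb)[w ws lw].
apply: linked_trans lv (linked_trans _ (linked_sym lw)).
apply: (next_ind (Q := fun w => linked P (right_cell s v) (right_cell s w)) _ vs ws).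
- by case: cb.
- by move=> u us lu; apply: linked_trans lu (right_cell_next cb us).
- exact: linked_refl.
Qed.

(** * Potentials of cochains *)

Lemma adjacent_wlog (R : vertex -> vertex -> Prop) v w :
  (forall u u', R u u' -> R u' u) ->
  (forall u, R u (u + e1)) -> (forall u, R u (u + e2)) ->
  (forall u, R (u + e1) (u + e2)) -> adjacent v w -> R v w.
Proof.
move=> sym H1 H2 H12 vw; have -> : w = v + (w - v) by rewrite addrC subrK.
move: (w - v) (vw : w - v \in units) => d {vw w} h; unit_cases h => //.
- have -> : v + (-1, 1) = (v - e1) + e2 by vertex_eq.
  by rewrite -{1}(subrK e1 v); apply: H12.
- by rewrite -{1}(subrK e1 v) -[v + _]/(v - e1); apply/sym/H1.
- by rewrite -{1}(subrK e2 v) -[v + _]/(v - e2); apply/sym/H2.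
- have -> : v + (1, -1) = (v - e2) + e1 by vertex_eq.
  by rewrite -{1}(subrK e2 v); apply/sym/H12.
Qed.

(* A 1-cochain on the grid is given by its values on the panes directed from v *)
(* to v + e1, from v + e2 to v, and from v + e1 to v + e2 respectively: with   *)
(* these directions the boundary of every cell is a directed cycle.            *)
Record cochain :=
  Cochain { coch1 : vertex -> rat; coch2 : vertex -> rat; coch12 : vertex -> rat }.

Definition closed_cochain (w : cochain) : Prop :=
  forall v, coch1 w v + coch2 w v + coch12 w v = 0 /\
            coch12 w v + coch2 w (v + e1) + coch1 w (v + e2) = 0.

Definition inside (P : {fset cell}) (w : cochain) : Prop :=
  forall v,
    [/\ ~~ (((v, true) \in P) && ((v - e2, false) \in P)) -> coch1 w v = 0,
        ~~ (((v, true) \in P) && ((v - e1, false) \in P)) -> coch2 w v = 0 &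
        ~~ (((v, true) \in P) && ((v, false) \in P)) -> coch12 w v = 0].

(* Minus the integral of the cochain along the ray from v in direction e1,     *)
(* which has left the support once the first coordinate reaches b.             *)
Definition potential (b : int) (w : cochain) (v : vertex) : rat :=
  - \sum_(k < absz (Num.max 0 (b - v.1))) coch1 w (v + e1 *+ k).

Definition supported (b : int) (w : cochain) : Prop :=
  forall v : vertex, b <= v.1 -> coch1 w v = 0 /\ coch2 w v = 0.

Lemma potential0 b w (v : vertex) : b <= v.1 -> potential b w v = 0.
Proof.
by move=> bv; rewrite /potential (_ : absz _ = 0%N) ?big_ord0 ?oppr0 //; lia.
Qed.

Lemma potential_e1 b w v : supported b w ->
  potential b w (v + e1) = potential b w v + coch1 w v.
Proof.
move=> supp; have [bv|vb] := lerP b v.1.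
  have [-> _] := supp _ bv; rewrite !potential0 ?addr0 //.
  by case: v bv => x y /=; lia.
rewrite /potential.
have -> : absz (Num.max 0 (b - v.1)) = (absz (Num.max 0 (b - (v + e1).1))).+1.
  by case: v vb => x y /=; lia.
rewrite big_ord_recl mulr0n addr0.
set S := \sum_(k < _) _; set S' := \sum_(i < _) _.
have -> : S = S' by apply: eq_bigr => k _; rewrite /= mulrS addrA.
by lra.
Qed.

(** Induction from the right, where everything vanishes: closedness on [(v, true)] and [(v, false)]
    carries the identity from [v + e1] to [v]. *)
Lemma potential_e2 b w v : supported b w -> closed_cochain w ->
  potential b w (v + e2) = potential b w v - coch2 w v.
Proof.
move=> supp cl; have [n] : exists n : nat, b - v.1 <= n%:Z.
  by exists (absz (b - v.1)); lia.
elim: n v => [|n IH] v vn.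
  have vb : b <= v.1 by lia.
  have [_ ->] := supp _ vb; rewrite !potential0 ?subr0 //.
  by case: (v) vb => x y /=; lia.
have [|bv] := lerP b v.1.
  move=> vb; have [_ ->] := supp _ vb; rewrite !potential0 ?subr0 //.
  by case: (v) vb => x y /=; lia.
have := IH (v + e1); rewrite addrAC !potential_e1 // => H.
have {H} /H E : b - (v + e1).1 <= n%:Z by case: (v) vn => x y /=; lia.
have [cu cd] := cl v; lra.
Qed.

Lemma potential_e12 b w v : supported b w -> closed_cochain w ->
  potential b w (v + e2) = potential b w (v + e1) + coch12 w v.
Proof.
move=> supp cl; rewrite potential_e1 // potential_e2 //.
by have [cu _] := cl v; lra.
Qed.

Lemma inside_supported P (b : int) w : {in P, forall c : cell, c.1.1 < b} ->
  inside P w -> supported b w.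
Proof.
move=> Pb win v bv; have [H1 H2 _] := win v.
have nv : (v, true) \notin P by apply/negP => /Pb /=; lia.
by split; [apply: H1|apply: H2]; rewrite (negPf nv).
Qed.

(** Boundary panes carry the value 0, so the potential is constant along the curve, and it is 0 at
    [v0]. *)
Lemma potential_boundary P s v0 w : clockwise_boundary P s -> v0 \in s ->
  {in P, forall c : cell, c.1.1 < v0.1} -> inside P w -> closed_cochain w ->
  {in s, forall v, potential v0.1 w v = 0}.
Proof.
move=> cb v0s Pb win cl v vs; have supp := inside_supported Pb win.
have us : uniq s by case: cb.
apply: (next_ind (Q := fun v => potential v0.1 w v = 0) us v0s vs); last first.
  exact: potential0.
move=> u su Eu.
have next_adj : adjacent u (next s u) by case: cb => _ _ ca _ _; exact: next_cycle ca su.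
have next_bd : u + next s u \in boundary_panes P.
  by case: cb => _ _ _ <- _; apply/mapP; exists u.
suff : u + next s u \in boundary_panes P ->
    potential v0.1 w u = potential v0.1 w (next s u) by move=> /(_ next_bd) <-.
pattern u, (next s u); apply: adjacent_wlog next_adj => {Eu next_bd su}u.
- by move=> u' H; rewrite addrC => /H.
- rewrite boundary_e1 potential_e1 // => bd; have [H _ _] := win u; rewrite H ?addr0 //.
  by case: (_ \in P) bd => // /=; case: (_ \in P).
- rewrite boundary_e2 potential_e2 // => bd; have [_ H _] := win u; rewrite H ?subr0 //.
  by case: (_ \in P) bd => // /=; case: (_ \in P).
- rewrite boundary_e12 potential_e12 // => bd; have [_ _ H] := win u; rewrite H ?addr0 //.
  by case: (_ \in P) bd => // /=; case: (_ \in P).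
Qed.

(** * Functions constant along trajectories *)

Lemma neighbors_wlog (R : cell -> cell -> Prop) c c' :
  (forall c, R c c) -> (forall c c', R c c' -> R c' c) ->
  (forall v, R (v, true) (v - e2, false)) ->
  (forall v, R (v, true) (v - e1, false)) ->
  (forall v, R (v, true) (v, false)) -> neighbors c c' -> R c c'.
Proof.
move=> rfl sym H1 H2 H12 [q qc qc']; have [v [w [vw qE _ _]]] := cell_pane_ends qc.
move: qc qc'; rewrite {}qE {q}; pattern v, w; apply: adjacent_wlog vw => {v w} v.
- by move=> w H; rewrite addrC; apply: H.
- by rewrite !mem_pane_e1 => /orP[]/eqP-> /orP[]/eqP-> //; apply/sym/H1.
- by rewrite !mem_pane_e2 => /orP[]/eqP-> /orP[]/eqP-> //; apply/sym/H2.
- by rewrite !mem_pane_e12 => /orP[]/eqP-> /orP[]/eqP-> //; apply/sym/H12.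
Qed.

(* Beams in the directions d and d' pass through the pane common to c and c'.  *)
Definition glue (T : Type) (P : {fset cell}) (g : cell -> vertex -> T)
    (c c' : cell) (d d' : vertex) : Prop :=
  [/\ c \in P -> c' \in P -> g c d = g c' d /\ g c d' = g c' d',
      c \in P -> c' \notin P -> g c d = g c d' &
      c \notin P -> c' \in P -> g c' d = g c' d'].

(* g assigns a value to each of the three beam segments in every cell, and is  *)
(* constant along the trajectories.                                            *)
Definition light_invariant (T : Type) (P : {fset cell}) (g : cell -> vertex -> T) :=
  forall v, [/\ glue P g (v, true) (v - e2, false) northeast southeast,
                glue P g (v, true) (v - e1, false) west southeast &
                glue P g (v, true) (v, false) northeast west].

(** The two beams through a pane cross it in opposite senses, so the winding sum jumps between its
    ends by the difference of their numbers. Each pane has exactly one upward side cell, from which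
    the numbers are read; if that cell is not in [P], the pane is not inside [P] and gets 0. *)
Definition light_cochain (P : {fset cell}) (g : cell -> vertex -> rat) : cochain :=
  let jump d d' v := if (v, true) \in P then g (v, true) d - g (v, true) d' else 0 in
  Cochain (jump southeast northeast) (jump west southeast) (jump northeast west).

Lemma light_cochain_closed P g :
  light_invariant P g -> closed_cochain (light_cochain P g).
Proof.
move=> inv v; split; rewrite /light_cochain /=; first by case: ifP => _; lra.
have [[H1 H2 H3] _ _] := inv (v + e2); have [_ [L1 L2 L3] _] := inv (v + e1).
have [_ _ [D1 D2 D3]] := inv v; rewrite ?addrK in H1 H2 H3 L1 L2 L3.
have [vP|nvP] := boolP ((v, false) \in P); last first.
  by case: ifP => [/D2 ->|_] //; case: ifP => [/L2 ->|_] //; case: ifP => [/H2 ->|_] //; lra.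
case: ifPn => [/D1 /(_ vP)[? ?]|/D3 /(_ vP) ?];
  (case: ifPn => [/L1 /(_ vP)[? ?]|/L3 /(_ vP) ?];
  (case: ifPn => [/H1 /(_ vP)[? ?]|/H3 /(_ vP) ?])); lra.
Qed.

Lemma light_cochain_inside P g : light_invariant P g -> inside P (light_cochain P g).
Proof.
move=> inv v; have [[_ H _] [_ L _] [_ D _]] := inv v; rewrite /light_cochain /=.
split=> out; case: ifP => // vP; rewrite vP /= in out.
- by rewrite (H vP out) subrr.
- by rewrite (L vP out) subrr.
- by rewrite (D vP out) subrr.
Qed.

Definition interior (P : {fset cell}) : {fset vertex} :=
  [fset v in region_vertices P | unit_hexagon v `<=` P].

Lemma interiorP P v :
  reflect (forall c, v \in cell_vertices c -> c \in P) (v \in interior P).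
Proof.
apply: (iffP idP).
  rewrite !inE => /andP[_ /fsubsetP sub] c vc; apply: sub.
  by rewrite in_unit_hexagon.
move=> vP; rewrite !inE; apply/andP; split.
  apply/bigfcupP; exists (v, true); rewrite ?inE ?eqxx //=.
  by rewrite vP // mem_head.
by apply/fsubsetP => c; rewrite in_unit_hexagon; apply: vP.
Qed.

Lemma interior_cells P u : u \in interior P ->
  [/\ [/\ (u, true) \in P, (u - e1, true) \in P & (u - e2, true) \in P],
      (u - e1, false) \in P, (u - e2, false) \in P & (u - e1 - e2, false) \in P].
Proof.
move=> /interiorP uP; split; first split; apply: uP; rewrite cell_verticesE /=.
- by rewrite mem_head.
- by rewrite subrK !inE eqxx ?orbT.
- by rewrite subrK !inE eqxx ?orbT.
- by rewrite subrK !inE eqxx ?orbT.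
- by rewrite subrK !inE eqxx ?orbT.
- by rewrite addrAC !subrK !inE eqxx ?orbT.
Qed.

(** Six beam segments pass next to [u]. Each crosses two consecutive panes at [u] in the same sense
    about [u], so its two contributions cancel in the alternating sum. *)
Lemma interior_equation P b g (u d : vertex) : light_invariant P g ->
  supported b (light_cochain P g) -> u \in interior P -> d \in units ->
  let X := potential b (light_cochain P g) in
  X (u + d) - X (u + ccw60 d) + X (u + ccw60 (ccw60 d))
  - X (u - d) + X (u - ccw60 d) - X (u - ccw60 (ccw60 d)) = 0.
Proof.
move=> inv supp uI dU; move=> X; have cl := light_cochain_closed inv.
have X1 v : X (v + e1) = X v + _ := potential_e1 v supp.
have X2 v : X (v + e2) = X v - _ := potential_e2 v supp cl.
have X12 v : X (v + e2) = X (v + e1) + _ := potential_e12 v supp cl.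
clearbody X; have [[u1P u2P u3P] v1P v2P v3P] := interior_cells uI.
have A1 := X1 u; have A2 := X2 u; have A3 := X12 (u - e1).
have A4 := X1 (u - e1); have A5 := X2 (u - e2); have A6 := X12 (u - e2).
rewrite ?subrK /= ?u1P ?u2P ?u3P in A1 A2 A3 A4 A5 A6.
have [_ [/(_ u1P v1P)[B1 B2] _ _] _] := inv u.
have [[/(_ u1P v2P)[B3 B4] _ _] _ _] := inv u.
have [_ _ [/(_ u2P v1P)[B5 B6] _ _]] := inv (u - e1).
have [[/(_ u2P v3P)[B7 B8] _ _] _ _] := inv (u - e1).
have [_ [/(_ u3P) + _ _] _] := inv (u - e2); rewrite addrAC => /(_ v3P)[B9 B10].
have [_ _ [/(_ u3P v2P)[B11 B12] _ _]] := inv (u - e2).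
have E1 : u + (0, 1) = u + e2 by []. have E2 : u + (1, 0) = u + e1 by [].
have E3 : u + (-1, 0) = u - e1 by []. have E4 : u + (0, -1) = u - e2 by [].
have E5 : u + (-1, 1) = u - e1 + e2 by vertex_eq.
have E6 : u + (1, -1) = u - e2 + e1 by vertex_eq.
by unit_cases dU; rewrite /ccw60 ?pairE /= ?oppr0 ?opprK ?addr0 ?add0r ?addrN ?addNr
  ?E1 ?E2 ?E3 ?E4 ?E5 ?E6; lra.
Qed.

(** Zero jumps equate the three values in an upward cell; a downward cell inherits this from passing
    or reflected beams, and [linked_cells] spreads the common value. *)
Lemma light_constant P s b g : clockwise_boundary P s -> light_invariant P g ->
  supported b (light_cochain P g) ->
  {in P, forall c, {in cell_vertices c, forall v,
     potential b (light_cochain P g) v = 0}} ->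
  {in P &, forall c c',
     {in beam_directions &, forall d d', g c d = g c' d'}}.
Proof.
move=> cb inv supp X0; have cl := light_cochain_closed inv.
have up v : (v, true) \in P ->
    g (v, true) northeast = g (v, true) southeast /\ g (v, true) west = g (v, true) southeast.
  move=> vP; have X0v w : w \in cell_vertices (v, true) -> _ := X0 _ vP w.
  have := potential_e1 v supp; have := potential_e2 v supp cl.
  by rewrite /= vP !X0v ?cell_verticesE ?inE ?eqxx ?orbT //; lra.
have same c : c \in P -> {in beam_directions, forall d, g c d = g c southeast}.
  move=> cP; suff [E1 E2] : g c northeast = g c southeast /\ g c west = g c southeast.
    by move=> d; rewrite !inE => /or3P[] /eqP->.
  case: c cP => v [] cP; first exact: up.
  have [[H1 _ H3] _ _] := inv (v + e2); have [_ [L1 _ L3] _] := inv (v + e1).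
  rewrite !addrK in H1 H3 L1 L3; split.
    have [vP|nvP] := boolP ((v + e2, true) \in P); last exact: H3.
    by have [<- <-] := H1 vP cP; have [] := up _ vP.
  have [vP|nvP] := boolP ((v + e1, true) \in P); last exact: L3.
  by have [<- <-] := L1 vP cP; have [] := up _ vP.
move=> c c' cP c'P d d' dD d'D; rewrite same // [RHS]same // {d d' dD d'D}.
elim: {c' cP c'P}(linked_cells cb cP c'P) => // c1 c2 c3 c1P c2P c12 _ <-.
move: c1P c2P; pattern c1, c2; apply: neighbors_wlog c12 => //.
- by move=> x y H yP xP; rewrite H.
- by move=> v vP wP; have [[/(_ vP wP)[]] ] := inv v.
- by move=> v vP wP; have [_ [/(_ vP wP)[]]] := inv v.
- move=> v vP wP; have [_ _ [/(_ vP wP)[E _] _ _]] := inv v.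
  by rewrite -[LHS](same _ vP northeast) ?inE ?eqxx // E same ?inE ?eqxx.
Qed.

(** * Elimination *)

Lemma fset_height_ind (I : {fset vertex}) (h : vertex -> int) (Q : vertex -> Prop) :
  {in I, forall v, {in I, forall u, h u < h v -> Q u} -> Q v} -> {in I, forall v, Q v}.
Proof.
move=> step v0 v0I.
have [|m mI mmin] := @seq_maximum _ (fun v => - h v) I.
  by apply: contraTneq v0I => E; rewrite -[_ \in _]/(v0 \in (I : seq vertex)) E.
have [n] : exists n : nat, h v0 - h m <= n%:Z by exists (absz (h v0 - h m)); lia.
elim: n v0 v0I => [|n IH] v vI vn; apply: step => // u uI uv.
  by have := mmin _ uI; lia.
by apply: IH => //; lia.
Qed.

(* The linear form with values 1 on d, 3 on ccw60 d and 2 on its rotation.     *)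
Definition height (d v : vertex) : int :=
  d.1 * v.1 + (d.1 + d.2) * v.2 + 2 * (d.1 * v.2 - d.2 * v.1).

Lemma heightD d u v : height d (u + v) = height d u + height d v.
Proof. by case: d u v => [a b] [x y] [x' y']; rewrite /height /=; lia. Qed.

Lemma heightN d v : height d (- v) = - height d v.
Proof. by case: d v => [a b] [x y]; rewrite /height /=; lia. Qed.

Lemma height_units d : d \in units ->
  [/\ height d d = 1, height d (ccw60 d) = 3 & height d (ccw60 (ccw60 d)) = 2].
Proof. by move=> h; unit_cases h; rewrite /height /ccw60 /=; split; lia. Qed.

Definition alternating (X : vertex -> rat) (u d : vertex) : rat :=
  X (u + d) - X (u + ccw60 d) + X (u + ccw60 (ccw60 d))
  - X (u - d) + X (u - ccw60 d) - X (u - ccw60 (ccw60 d)).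

(* In the equation at u the value at u + ccw60 d is the one of largest height, *)
(* so it is determined by the values at smaller heights.                       *)
Lemma sweep (I : {fset vertex}) X d (E : pred vertex) : d \in units ->
  {in I, forall u, alternating X u d = 0} ->
  {in I, forall u, {in units, forall e, u + e \notin I -> X (u + e) = 0}} ->
  {in I, forall v, v - ccw60 d \notin I -> ~~ E v -> X v = 0} ->
  {in I, forall v, E v ->
    {in I, forall u, height d u < height d v -> X u = 0} -> X v = 0} ->
  {in I, forall v, X v = 0}.
Proof.
move=> dU eqn out init exc; apply: (fset_height_ind (h := height d)) => v vI low.
have [Ev|nEv] := boolP (E v); first exact: exc.
have [uI|/init->//] := boolP (v - ccw60 d \in I).
set u := v - ccw60 d in uI; have vE : v = u + ccw60 d by rewrite subrK.
have [h1 h3 h2] := height_units dU.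
have d3U := ccw60_unit dU; have d2U := ccw60_unit d3U.
have X0 e : e \in units -> height d e < 3 -> X (u + e) = 0.
  move=> eU he; have [ueI|] := boolP (u + e \in I); last exact: out.
  by apply: low => //; rewrite vE !heightD h3 ltrD2l.
have := eqn _ uI; rewrite /alternating -vE !X0 ?heightN ?h1 ?h2 ?h3 ?opp_unit //.
by lra.
Qed.

(** * The rank bound on the number of trajectories *)

Lemma light_invariant_comp (T T' : Type) P (g : cell -> vertex -> T) (f : T -> T') :
  light_invariant P g -> light_invariant P (fun c d => f (g c d)).
Proof.
move=> inv v; have [[H1 H2 H3] [L1 L2 L3] [D1 D2 D3]] := inv v.
by split; split; move=> p q;
  [have [-> ->] := H1 p q|rewrite (H2 p q)|rewrite (H3 p q)
  |have [-> ->] := L1 p q|rewrite (L2 p q)|rewrite (L3 p q)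
  |have [-> ->] := D1 p q|rewrite (D2 p q)|rewrite (D3 p q)].
Qed.

Lemma potential_sum b P n (a : 'I_n -> rat) (g : 'I_n -> cell -> vertex -> rat) v :
  potential b (light_cochain P (fun c d => \sum_j a j * g j c d)) v
  = \sum_j a j * potential b (light_cochain P (g j)) v.
Proof.
rewrite /potential -sumrN; under [RHS]eq_bigr do rewrite -sumrN mulr_sumr.
rewrite exchange_big; apply: eq_bigr => k _ /=; case: ifP => _.
  by rewrite -sumrB -sumrN; apply: eq_bigr => j _; lra.
by rewrite big1 ?oppr0 // => j _; rewrite mulr0.
Qed.

Lemma potential_vertices P s v0 w c v : clockwise_boundary P s -> v0 \in s ->
  {in P, forall c : cell, c.1.1 < v0.1} -> inside P w -> closed_cochain w ->
  c \in P -> v \in cell_vertices c -> v \notin interior P -> potential v0.1 w v = 0.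
Proof.
move=> cb v0s Pb win cl cP vc vI; have [vs|vs] := boolP (v \in s).
  exact: (potential_boundary cb v0s Pb win cl).
case/negP: vI; apply/interiorP => c' vc'.
by rewrite -(cells_around cb vs vc vc').
Qed.

Lemma boundary_cell P s : clockwise_boundary P s -> exists c, c \in P.
Proof.
move=> cb; have [v vs _] := rightmost_boundary cb.
by have [_ rP _] := boundary_step cb vs; exists (corner v (cw60 (next s v - v))).
Qed.

(* An invariant function is determined up to a constant by its potential, and  *)
(* the potential by its values on D.                                           *)
Lemma light_classes_leq (T : eqType) P s (g : cell -> vertex -> T) v0
    (D : seq vertex) (O : seq T) :
  clockwise_boundary P s -> v0 \in s -> {in P, forall c : cell, c.1.1 < v0.1} ->
  light_invariant P g ->
  (forall f : cell -> vertex -> rat, light_invariant P f ->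
     {in D, forall v, potential v0.1 (light_cochain P f) v = 0} ->
     {in interior P, forall v, potential v0.1 (light_cochain P f) v = 0}) ->
  uniq O ->
  {in O, forall o, exists c d, [/\ c \in P, d \in beam_directions & o = g c d]} ->
  (size O <= (size D).+1)%N.
Proof.
move=> cb v0s Pb inv det uO Og; have [c0 c0P] := boundary_cell cb.
case: O uO Og => // o0 O'; set O := o0 :: O' => uO Og; set n := size O.
pose ind (j : 'I_n) c d : rat := (g c d == nth o0 O j)%:R.
(* One row for the indicator of each element of [O]; the columns are its potentials on [D], and one
   more column ([ord0]) that fixes the additive constant. A linear relation between the rows is an
   invariant that vanishes everywhere. *)
pose W : 'M[rat]_(n, (size D).+1) := \matrix_(j, k)
  if unlift ord0 k is Some k' then potential v0.1 (light_cochain P (ind j)) (nth 0 D k')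
  else ind j c0 southeast.
suff /eqP rW : row_free W by rewrite -rW rank_leq_col.
rewrite -kermx_eq0; apply/eqP/row_matrixP => i; rewrite row0.
set a := row i _; have aW : a *m W = 0 by rewrite -row_mul mulmx_ker row0.
pose f c d := \sum_j a 0 j * ind j c d.
have fE : light_invariant P f.
  exact: (light_invariant_comp (fun o => \sum_j a 0 j * (o == nth o0 O j)%:R)).
have f0 : f c0 southeast = 0.
  have := congr1 (fun M : 'rV_ _ => M 0 ord0) aW; rewrite !mxE => E; rewrite -[RHS]E.
  by apply: eq_bigr => j _; rewrite !mxE unlift_none.
have fD : {in D, forall v, potential v0.1 (light_cochain P f) v = 0}.
  move=> v vD; have vlt : (index v D < size D)%N by rewrite index_mem.
  rewrite potential_sum.
  have := congr1 (fun M : 'rV_ _ => M 0 (lift ord0 (Ordinal vlt))) aW.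
  rewrite !mxE => E; rewrite -[RHS]E; apply: eq_bigr => j _; rewrite !mxE liftK /=.
  by rewrite nth_index.
have win := light_cochain_inside fE; have cl := light_cochain_closed fE.
have fI := det _ fE fD.
have const := light_constant cb fE (inside_supported Pb win).
have {}const : {in P, forall c, {in beam_directions, forall d, f c d = 0}}.
  move=> c cP d dD; rewrite -f0; apply: const => // {}c {}cP v vc.
  have [/fI//|vI] := boolP (v \in interior P).
  exact: (potential_vertices cb v0s Pb win cl cP vc vI).
apply/rowP => j; rewrite [RHS]mxE.
have [c [d [cP dD jE]]] := Og _ (mem_nth o0 (ltn_ord j)).
have := const _ cP _ dD; rewrite /f (bigD1 j) //= /ind -jE eqxx mulr1 big1 ?addr0 //.
by move=> k kj; rewrite nth_uniq // eq_sym (inj_eq val_inj) (negPf kj) mulr0.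
Qed.

Definition light_classes (T : eqType) P (g : cell -> vertex -> T) (O : seq T) :=
  [/\ light_invariant P g, uniq O &
   {in O, forall o, exists c d, [/\ c \in P, d \in beam_directions & o = g c d]}].

Lemma light_sweep P s v0 f d (E : pred vertex) : clockwise_boundary P s -> v0 \in s ->
  {in P, forall c : cell, c.1.1 < v0.1} -> light_invariant P f -> d \in units ->
  let X := potential v0.1 (light_cochain P f) in
  {in interior P, forall u, {in units, forall e, u + e \notin interior P -> X (u + e) = 0}} /\
  ({in interior P, forall v, v - ccw60 d \notin interior P -> ~~ E v -> X v = 0} ->
   {in interior P, forall v, E v ->
     {in interior P, forall u, height d u < height d v -> X u = 0} -> X v = 0} ->
   {in interior P, forall v, X v = 0}).
Proof.
move=> cb v0s Pb inv dU X; have win := light_cochain_inside inv.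
have cl := light_cochain_closed inv; have supp := inside_supported Pb win.
have out : {in interior P, forall u, {in units, forall e,
    u + e \notin interior P -> X (u + e) = 0}}.
  move=> u uI e eU; apply: (potential_vertices (c := corner u e) cb v0s Pb win cl).
    by move/interiorP: uI; apply; rewrite corner_vertices // mem_head.
  by rewrite corner_vertices // !inE eqxx ?orbT.
split=> //; apply: sweep => // u uI; exact: interior_equation supp uI dU.
Qed.

Definition exits (I : {fset vertex}) (d : vertex) : seq vertex :=
  [seq v <- I | v + d \notin I].

Lemma light_classes_dir (T : eqType) P s (g : cell -> vertex -> T) O d :
  clockwise_boundary P s -> light_classes P g O -> d \in units ->
  (size O <= (size (exits (interior P) d)).+1)%N.
Proof.
move=> cb [inv uO Og] dU; have [v0 v0s Pb] := rightmost_boundary cb.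
apply: (light_classes_leq cb v0s Pb inv _ uO Og) => f finv X0.
(* The sweep along [cw60 (- d)] needs initial values where [v - ccw60 (cw60 (- d))], which is
   [v + d], is not interior, that is, on the exits in direction [d]. *)
have dU' := cw60_unit (opp_unit dU).
have [_] := light_sweep pred0 cb v0s Pb finv dU'; apply=> // v vI + _.
by rewrite cw60K opprK => vd; apply: X0; rewrite mem_filter vd.
Qed.

(** As no three interior vertices form a cell, [u + ccw60 d], the highest neighbour of [u], is not
    interior. The equation at [u] is thus free to determine the highest interior neighbour [w],
    which would otherwise count among the initial values. *)
Lemma light_classes_strict (T : eqType) P s (g : cell -> vertex -> T) O u d :
  clockwise_boundary P s -> light_classes P g O -> d \in units ->
  {in interior P, forall v, {in units, forall e, v + e \in interior P ->
     v + ccw60 e \notin interior P}} ->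
  u \in interior P -> u + d \in interior P ->
  exists2 d', d' \in units &
    (size O <= size (exits (interior P) d'))%N.
Proof.
move=> cb [inv uO Og] dU no3 uI udI; have [v0 v0s Pb] := rightmost_boundary cb.
set I := interior P in no3 uI udI *.
have [h1 h3 h2] := height_units dU.
have d3U := ccw60_unit dU; have d2U := ccw60_unit d3U.
have dE : ccw60 d = d + ccw60 (ccw60 d).
  by case: (d) => a b; rewrite /ccw60 /=; congr pair; rewrite /=; lia.
exists (- ccw60 d); first exact: opp_unit.
pose w := if u + ccw60 (ccw60 d) \in I then u + ccw60 (ccw60 d) else u + d.
have wI : w \in I by rewrite /w; case: ifP.
have wD : w - ccw60 d \notin I.
  rewrite /w; case: ifP => [u2I|_]; apply/negP => zI.
    have := no3 _ zI _ dU; rewrite -addrA (_ : - ccw60 d + d = - ccw60 (ccw60 d)); last first.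
      by rewrite {1}dE opprD addrAC addNr add0r.
    by rewrite addrK subrK u2I => /(_ uI).
  have := no3 _ zI _ d3U; rewrite subrK udI => /(_ isT)/negP; apply.
  by rewrite -addrA -addrA {1}dE opprD -addrA addNr addr0 subrr addr0.
set D := exits _ _; pose D' := rem w D.
have wInD : w \in D by rewrite mem_filter wD.
have -> : size D = (size D').+1 by rewrite size_rem // prednK // -has_predT; apply/hasP; exists w.
apply: (light_classes_leq cb v0s Pb inv _ uO Og) => f finv X0.
have [out] := light_sweep (pred1 w) cb v0s Pb finv dU.
set X := potential _ _ in X0 out *; apply=> [v vI vd /= vw|v vI /eqP-> {v vI} low].
  by apply: X0; rewrite mem_rem_uniq ?inE ?vw ?mem_filter ?vd // filter_uniq ?fset_uniq.
have win := light_cochain_inside finv; have supp := inside_supported Pb win.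
have : alternating X u d = 0 by exact: interior_equation finv supp uI dU.
rewrite /alternating.
have Xlow e : e \in units -> (u + e \in I -> height d (u + e) < height d w) -> X (u + e) = 0.
  by move=> eU lt; have [ueI|] := boolP (u + e \in I); [apply: low => //; exact: lt|exact: out].
have X3 : X (u + ccw60 d) = 0 by apply: out => //; exact: no3.
have hw : height d u + 1 <= height d w by rewrite /w; case: ifP => _; rewrite heightD ?h1 ?h2 // lerD2l.
have hlow e : height d e < 1 -> height d (u + e) < height d w.
  by move=> he; apply: lt_le_trans hw; rewrite heightD ltrD2l.
have Xm1 : X (u - d) = 0 by apply: Xlow; rewrite ?opp_unit // hlow // heightN h1.
have Xm3 : X (u - ccw60 d) = 0 by apply: Xlow; rewrite ?opp_unit // hlow // heightN h3.
have Xm2 : X (u - ccw60 (ccw60 d)) = 0.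
  by apply: Xlow; rewrite ?opp_unit // hlow // heightN h2.
rewrite X3 Xm1 Xm2 Xm3; case: (boolP (u + ccw60 (ccw60 d) \in I)) => [u2I|u2I].
  have wE : w = u + ccw60 (ccw60 d) by rewrite /w u2I.
  have X1 : X (u + d) = 0 by apply: Xlow => // _; rewrite wE !heightD h1 h2 ltrD2l.
  by rewrite X1 wE; lra.
have wE : w = u + d by rewrite /w (negPf u2I).
by rewrite (out _ uI _ d2U u2I) wE; lra.
Qed.

Lemma corner_eq v d v' d' : d \in units -> d' \in units ->
  corner v d = corner v' d' -> [\/ v' = v /\ d' = d, v' = v + d | v = v' + d'].
Proof.
case: v v' => [x y] [x' y'] h h'.
by unit_cases h; unit_cases h'; rewrite /corner /e1 /e2 ?pairE /= ?pairE /= => -[] => // ? ?;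
  first [constructor 1; split=> //; congr pair; lia | constructor 2; congr pair; lia
        | constructor 3; congr pair; lia | exfalso; lia].
Qed.

(** * Counting mixed cells *)

Definition mixed_corners (I : {fset vertex}) : seq cell :=
  [seq corner v d | d <- units, v <- exits I d].

(** Going once around the three vertices of a cell, at most one step leads from [I] out of [I]. *)
Lemma mixed_corners_uniq I : uniq (mixed_corners I).
Proof.
apply: allpairs_uniq_dep => // [d _|[d v] [d' v']]; first by rewrite filter_uniq ?fset_uniq.
move=> /allpairsPdep[d1 [v1 [d1U + [-> ->]]]] /allpairsPdep[d2 [v2 [d2U + [-> ->]]]] /=.
rewrite !mem_filter => /andP[n1 v1I] /andP[n2 v2I] /(corner_eq d1U d2U)[[-> ->]//|E|E].
  by rewrite E (negPf n1) in v2I.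
by rewrite E (negPf n2) in v1I.
Qed.

Lemma mixed_corners_sub P : {subset mixed_corners (interior P) <= P}.
Proof.
move=> c /allpairsPdep[d [v [dU + ->]]]; rewrite mem_filter => /andP[_ /interiorP].
by apply; rewrite corner_vertices // mem_head.
Qed.

Lemma sumn_units (a : vertex -> nat) k :
  {in units, forall d, (k <= (a d).+1)%N} ->
  (6 * k <= sumn [seq a d | d <- units] + 6)%N /\
  ((exists2 d, d \in units & (k <= a d)%N) ->
   (6 * k < sumn [seq a d | d <- units] + 6)%N).
Proof.
have arith (a1 a2 a3 a4 a5 a6 : nat) : (k <= a1.+1)%N -> (k <= a2.+1)%N ->
    (k <= a3.+1)%N -> (k <= a4.+1)%N -> (k <= a5.+1)%N -> (k <= a6.+1)%N ->
    let n := (a1 + (a2 + (a3 + (a4 + (a5 + (a6 + 0))))) + 6)%N in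
    (6 * k <= n)%N /\
    ((k <= a1 \/ k <= a2 \/ k <= a3 \/ k <= a4 \/ k <= a5 \/ k <= a6)%N ->
     (6 * k < n)%N) by move=> *; lia.
move=> H; have [le lt] := arith _ _ _ _ _ _ (H e1 isT) (H e2 isT) (H (e2 - e1) isT)
  (H (- e1) isT) (H (- e2) isT) (H (e1 - e2) isT).
split=> // -[d dU kd]; apply: lt; move: dU kd; rewrite !inE.
by move=> /orP[|/orP[|/orP[|/orP[|/orP[|]]]]] /eqP->; tauto.
Qed.

Lemma size_mixed_corners I :
  size (mixed_corners I) = sumn [seq size (exits I d) | d <- units].
Proof. exact: size_allpairs_dep. Qed.

Lemma light_classes_area (T : eqType) P s (g : cell -> vertex -> T) O :
  clockwise_boundary P s -> light_classes P g O -> (6 * size O <= #|` P| + 6)%N.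
Proof.
move=> cb lc; have [le _] := sumn_units (fun d => @light_classes_dir _ _ _ _ _ d cb lc).
apply: leq_trans le _; rewrite leq_add2r -size_mixed_corners.
exact: uniq_leq_size (mixed_corners_uniq _) (@mixed_corners_sub P).
Qed.

(** Equality forces [mixed_corners] to exhaust [P], so every cell has both an interior and a
    non-interior vertex. This rules out interior triangles, and [light_classes_strict] then rules
    out adjacent interior vertices. *)
Lemma light_classes_extremal (T : eqType) P s (g : cell -> vertex -> T) O :
  clockwise_boundary P s -> light_classes P g O -> (#|` P| + 6 = 6 * size O)%N ->
  {in P, forall c, exists2 v, v \in interior P & v \in cell_vertices c} /\
  {in interior P &, forall u v, ~ adjacent u v}.
Proof.
move=> cb lc E; have sub := @mixed_corners_sub P; have uL := mixed_corners_uniq (interior P).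
have [le lt] := sumn_units (fun d => @light_classes_dir _ _ _ _ _ d cb lc).
have LP : mixed_corners (interior P) =i P.
  have [|_ //] := uniq_min_size uL sub.
  by move: le; rewrite -E leq_add2r size_mixed_corners.
split=> [c|].
  rewrite -LP => /allpairsPdep[d [v [dU + ->]]]; rewrite mem_filter => /andP[_ vI].
  by exists v => //; rewrite corner_vertices // mem_head.
have no3 : {in interior P, forall v, {in units, forall e, v + e \in interior P ->
     v + ccw60 e \notin interior P}}.
  move=> v vI e eU veI; apply/negP => vceI.
  have : corner v e \in P by move/interiorP: (vI); apply; rewrite corner_vertices // mem_head.
  rewrite -LP => /allpairsPdep[d [w [dU + cE]]]; rewrite mem_filter => /andP[wd wI].
  have : w + d \in cell_vertices (corner v e).
    by rewrite cE corner_vertices // !inE eqxx orbT.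
  by rewrite corner_vertices // !inE => /or3P[]/eqP wE; move: wd; rewrite wE ?vI ?veI ?vceI.
move=> u v uI vI uv; have := light_classes_strict cb lc uv no3 uI.
rewrite addrC subrK => /(_ vI) /lt; rewrite -E ltn_add2r -size_mixed_corners.
by rewrite ltnNge (uniq_leq_size uL sub).
Qed.

(** * Trajectories of the billiards permutation *)

(* A beam in direction d enters c through entry c d, leaves c through          *)
(* entry c d + d into across c d, or is reflected there into direction         *)
(* turn c d.                                                                   *)
Definition entry (c : cell) (d : vertex) : pane :=
  let: (v, up) := c in
  if up then
    if d == northeast then v + (v + e1) else
    if d == west then (v + e1) + (v + e2) else v + (v + e2)
  else
    if d == southeast then (v + e2) + (v + e2 + e1) else
    if d == west then (v + e1) + (v + e1 + e2) else (v + e1) + (v + e2).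

Definition across (c : cell) (d : vertex) : cell :=
  let: (v, up) := c in
  if up then
    if d == northeast then (v, false) else
    if d == west then (v - e1, false) else (v - e2, false)
  else
    if d == southeast then (v + e1, true) else
    if d == west then (v, true) else (v + e2, true).

Definition turn (c : cell) (d : vertex) : vertex :=
  if c.2 then
    if d == northeast then west else if d == west then southeast else northeast
  else
    if d == southeast then west else if d == west then northeast else southeast.

Lemma turn_direction c d : turn c d \in beam_directions.
Proof. by rewrite /turn; do !case: ifP => _. Qed.

Lemma exitE c d : d \in beam_directions -> entry c d + d =
  let: (v, up) := c in
  if up then
    if d == northeast then (v + e1) + (v + e2) else
    if d == west then v + (v + e2) else v + (v + e1)
  else
    if d == southeast then (v + e1) + (v + e1 + e2) else
    if d == west then (v + e1) + (v + e2) else (v + e2) + (v + e2 + e1).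
Proof.
case: c => v up /beam_directionP[] ->; case: up;
  rewrite /entry /northeast /southeast /west /e1 /e2 ?pairE /=; vertex_eq.
Qed.

Lemma entry_turn c d : d \in beam_directions -> entry c (turn c d) = entry c d + d.
Proof.
by move=> dD; rewrite exitE //; case: c => v up; case/beam_directionP: dD => ->; case: up.
Qed.

Lemma entry_across c d : d \in beam_directions -> entry (across c d) d = entry c d + d.
Proof.
move=> dD; rewrite exitE //; case: c => v up.
by case/beam_directionP: dD => ->; case: up => //=; rewrite /across /= ?subrK // addrAC subrK.
Qed.

Lemma mem_entry c d : d \in beam_directions ->
  entry c d \in cell_panes c /\ entry c d + d \in cell_panes c.
Proof.
move=> dD; rewrite exitE //; case: c => v up; case/beam_directionP: dD => ->; case: up => /=;
  by rewrite !inE ?(addrAC v e2 e1) ?eqxx ?orbT.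
Qed.

Lemma exit_of_pane c q : q \in cell_panes c ->
  exists2 d, d \in beam_directions & entry c d + d = q.
Proof.
case: c => v [] /[!inE] /or3P[] /eqP->;
  [exists southeast|exists west|exists northeast|exists west|exists southeast|exists northeast] => //;
  by rewrite exitE //= ?(addrAC v e2 e1).
Qed.

Lemma exit_inj c d d' : d \in beam_directions -> d' \in beam_directions ->
  entry c d + d = entry c d' + d' -> d = d'.
Proof.
move=> dD d'D E; have [qc qd] := mem_entry c dD; have [qc' _] := mem_entry c d'D.
apply: (cell_panes_uniq_dir qd) => //; first by rewrite addrK.
by rewrite E addrK.
Qed.

Lemma exit_boundary P c d : d \in beam_directions ->
  (entry c d + d \in boundary_panes P) = (c \in P) (+) (across c d \in P).
Proof.
move=> dD; rewrite exitE //; case: c => v up; case/beam_directionP: dD => ->; case: up => /=;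
  by rewrite ?boundary_e1 ?boundary_e2 ?boundary_e12 ?addrK // addbC.
Qed.

(** The conditions at panes suit cochains; this form suits following a beam, which either passes on
    or is reflected. *)
Lemma light_invariant_acrossP (T : Type) P (g : cell -> vertex -> T) :
  light_invariant P g <->
  {in P, forall c, {in beam_directions, forall d,
    (across c d \in P -> g c d = g (across c d) d) /\
    (across c d \notin P -> g c d = g c (turn c d))}}.
Proof.
split=> [inv [v up] cP d /beam_directionP dD|H v].
  have [[H1 H2 H3] [L1 L2 L3] [D1 D2 D3]] := inv v.
  have [[H1' H2' H3'] _ _] := inv (v + e2); have [_ [L1' L2' L3'] _] := inv (v + e1).
  rewrite !addrK in H1' H2' H3' L1' L2' L3'.
  by case: up cP dD => cP [] ->; split=> zP; rewrite /across /turn /= in zP *;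
  [case: (D1 cP zP)|exact: D2|case: (H1 cP zP)|exact/esym/H2|case: (L1 cP zP)|exact: L2
  |case: (H1' zP cP)|exact: H3'|case: (L1' zP cP)|exact/esym/L3'|case: (D1 zP cP)|exact/esym/D3].
have NE : northeast \in beam_directions by [].
have SE : southeast \in beam_directions by [].
have W : west \in beam_directions by [].
have up d (dD : d \in beam_directions) := fun cP => H (v, true) cP d dD.
have dn d (dD : d \in beam_directions) w := fun cP => H (w, false) cP d dD.
split; split=> vP wP.
- have [+ _] := up _ SE vP; have [+ _] := dn _ NE _ wP.
  by rewrite /across /= subrK => -> // ->.
- by have [_ <-] := up _ SE vP.
- have [_] := dn _ NE _ wP; rewrite /across /= subrK => -> //.
- have [+ _] := up _ W vP; have [+ _] := dn _ SE _ wP.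
  by rewrite /across /= subrK => -> // ->.
- by have [_ ->] := up _ W vP.
- by have [_] := dn _ SE _ wP; rewrite /across /= subrK => ->.
- have [+ _] := up _ NE vP; have [+ _] := dn _ W _ wP.
  by rewrite /across /= => -> // ->.
- by have [_ ->] := up _ NE vP.
- by have [_ ->] := dn _ W _ wP.
Qed.

(** [n] is fuel. The number of panes of the region is enough for a beam, since it meets pairwise
    distinct panes ([beam_stops]). *)
Fixpoint ray (n : nat) (P : {fset cell}) (d : vertex) (q : pane) : pane :=
  if n is m.+1 then
    if q + d \in boundary_panes P then q + d else ray m P d (q + d)
  else q.

Lemma rayE P d n k q : (k < n)%N ->
  (forall i, (i < k)%N -> q + d *+ i.+1 \notin boundary_panes P) ->
  q + d *+ k.+1 \in boundary_panes P -> ray n P d q = q + d *+ k.+1.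
Proof.
elim: n k q => // n IH [|k] q kn nb /=; first by move=> ->.
have := nb 0%N isT; rewrite mulr1n => /negPf-> kb.
rewrite [in RHS]mulrS addrA; apply: IH => //; last by rewrite -addrA -mulrS.
by move=> i ik; rewrite -addrA -mulrS nb.
Qed.

Lemma beam_stops P d q : d \in beam_directions -> crosses P d q ->
  exists k, [/\ (k < size (region_panes P))%N,
    (forall i, (i <= k)%N -> crosses P d (q + d *+ i)),
    (forall i, (i < k)%N -> q + d *+ i.+1 \notin boundary_panes P) &
    q + d *+ k.+1 \in boundary_panes P].
Proof.
move=> dD cr; set N := size _.
have cross k : (forall i, (i < k)%N -> q + d *+ i.+1 \notin boundary_panes P) ->
    crosses P d (q + d *+ k).
  elim: k => [|k IH] nb; first by rewrite addr0.
  rewrite mulrSr addrA; apply: beam_continues => //; last by rewrite -addrA -mulrSr nb.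
  by apply: IH => i ik; apply/nb/ltnW.
have ex : exists k, (k < N)%N && (q + d *+ k.+1 \in boundary_panes P).
  have [/hasP[k]|/hasPn no] :=
    boolP (has (fun k => q + d *+ k.+1 \in boundary_panes P) (iota 0 N)).
    by rewrite mem_iota => /= kN kb; exists k; rewrite kN.
  suff : (N.+1 <= N)%N by rewrite ltnn.
  rewrite -[X in (X <= _)%N](size_iota 0) -(size_map (fun k => q + d *+ k)).
  apply: uniq_leq_size => [|r /mapP[k]].
    rewrite map_inj_uniq ?iota_uniq // => k l /addrI.
    exact/mulrn_inj_pair/direction_neq0.
  rewrite mem_iota add0n ltnS => kN ->.
  have [|c cP /andP[qc _]] := cross k.
    by move=> i ik; apply: no; rewrite mem_iota (leq_trans ik).
  by apply/mem_region_panes; exists c.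
case: (ex_minnP ex) => k /andP[kN kb] kmin.
have nb i : (i < k)%N -> q + d *+ i.+1 \notin boundary_panes P.
  move=> ik; apply/negP => ib; have := kmin i; rewrite ib (ltn_trans ik kN) leqNgt ik.
  by move=> /(_ isT).
by exists k; split=> // i ik; apply: cross => j ji; apply/nb/(leq_trans ji).
Qed.

Definition hit (P : {fset cell}) (c : cell) (d : vertex) : pane :=
  ray (size (region_panes P)) P d (entry c d).

Lemma hit_exists P c d : c \in P -> d \in beam_directions ->
  exists k, [/\ (k < size (region_panes P))%N /\
      (forall i, (i <= k)%N -> crosses P d (entry c d + d *+ i)),
    (forall i, (i < k)%N -> entry c d + d *+ i.+1 \notin boundary_panes P),
    entry c d + d *+ k.+1 \in boundary_panes P &
    hit P c d = entry c d + d *+ k.+1].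
Proof.
move=> cP dD; have [qc rc] := mem_entry c dD.
have [|k [kN cr nb kb]] := @beam_stops P d (entry c d) dD.
  by exists c; rewrite ?qc.
by exists k; split=> //; apply: rayE.
Qed.

Lemma hit_boundary P c d : c \in P -> d \in beam_directions ->
  hit P c d \in boundary_panes P.
Proof. by move=> cP dD; have [k [_ _ ? ->]] := hit_exists cP dD. Qed.

Lemma hit_exit P c d : c \in P -> d \in beam_directions -> across c d \notin P ->
  hit P c d = entry c d + d.
Proof.
move=> cP dD nP; have [k [_ nb _ ->]] := hit_exists cP dD.
case: k nb => [|k] nb; first by rewrite mulr1n.
by have := nb 0%N isT; rewrite mulr1n exit_boundary // cP (negPf nP).
Qed.

Lemma hit_across P c d : c \in P -> d \in beam_directions -> across c d \in P ->
  hit P c d = hit P (across c d) d.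
Proof.
move=> cP dD c'P; have [k [[kN _] nb kb E]] := hit_exists cP dD.
have nb0 : entry c d + d \notin boundary_panes P by rewrite exit_boundary // cP c'P.
case: k kN nb kb E => [|k] kN nb kb E; first by rewrite mulr1n (negPf nb0) in kb.
have Ei i : entry c d + d + d *+ i.+1 = entry c d + d *+ i.+2 by rewrite -addrA -mulrS.
rewrite E /hit entry_across // (rayE (k := k)) ?Ei // ?(ltnW kN) // => i ik.
by rewrite Ei nb.
Qed.

Lemma hit_beam P c d : c \in P -> d \in beam_directions ->
  beam P (entry c d) (hit P c d).
Proof.
move=> cP dD; have [k [[_ cr] nb kb E]] := hit_exists cP dD.
exists d => //; exists k.+1; split; rewrite ?E // => i.
by case: i => // i /nb.
Qed.

(** The union has a single member when [hit P c d] is a boundary pane; it makes the cycle a total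
    function of [c] and [d]. *)
Definition trajectory (P : grid_polygon) (c : cell) (d : vertex) :
    {set 'I_(size (panes P))} :=
  \bigcup_(i : 'I_(size (panes P)) | (panes P)`_i == hit P c d) porbit (billiards P) i.

Arguments trajectory : clear implicits.

Lemma trajectoryE (P : grid_polygon) c d (i : 'I_(size (panes P))) :
  hit P c d = (panes P)`_i -> trajectory P c d = porbit (billiards P) i.
Proof.
move=> E; rewrite /trajectory (big_pred1 i) // => j.
by rewrite E nth_uniq ?panes_uniq.
Qed.

Lemma hit_pane (P : grid_polygon) c d : c \in cells P -> d \in beam_directions ->
  exists i : 'I_(size (panes P)), hit P c d = (panes P)`_i.
Proof.
move=> cP dD; have := hit_boundary cP dD; rewrite -mem_panes => qP.
have lt : (index (hit P c d) (panes P) < size (panes P))%N by rewrite index_mem.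
by exists (Ordinal lt); rewrite /= nth_index.
Qed.

Lemma trajectory_invariant (P : grid_polygon) :
  light_invariant P (trajectory P).
Proof.
apply/light_invariant_acrossP => c cP d dD; split=> zP.
  by rewrite /trajectory hit_across.
have tD := turn_direction c d; have [j jE] := hit_pane cP tD.
have [i iE] := hit_pane cP dD; rewrite (trajectoryE iE) (trajectoryE jE).
have /billiardsP <- : beam P (panes P)`_i (panes P)`_j.
  by rewrite -iE -jE hit_exit // -entry_turn //; apply: hit_beam.
by apply/eqP; rewrite eq_sym eq_porbit_mem -{1}[billiards P]expg1 mem_porbit.
Qed.

Lemma trajectory_surjective (P : grid_polygon) (i : 'I_(size (panes P))) :
  exists c d, [/\ c \in cells P, d \in beam_directions, entry c d + d = (panes P)`_i &
    trajectory P c d = porbit (billiards P) i].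
Proof.
have : (panes P)`_i \in boundary_panes P by rewrite -mem_panes mem_nth.
case/boundary_paneP=> c [cP qc] _; have [d dD E] := exit_of_pane qc.
exists c, d; split=> //; apply: trajectoryE; rewrite hit_exit //.
by have := exit_boundary P c dD; rewrite cP E -mem_panes mem_nth.
Qed.

Lemma light_invariant_hit (T : Type) P (g : cell -> vertex -> T) c d :
  light_invariant P g -> c \in P -> d \in beam_directions ->
  exists c', [/\ c' \in P, across c' d \notin P, entry c' d + d = hit P c d & g c' d = g c d].
Proof.
move=> /light_invariant_acrossP inv cP dD; have [k [_ nb kb E]] := hit_exists cP dD.
elim: k c cP nb kb E => [|k IH] c cP nb kb E.
  rewrite mulr1n in kb E; exists c; split=> //.
  by move: kb; rewrite exit_boundary // cP; case: (_ \in _).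
have c'P : across c d \in P.
  by have := nb 0%N isT; rewrite mulr1n exit_boundary // cP; case: (_ \in _).
have Ei i : entry (across c d) d + d *+ i.+1 = entry c d + d *+ i.+2.
  by rewrite entry_across // -addrA -mulrS.
have [|||c2 [? ? ? gE]] := IH _ c'P; rewrite ?Ei //.
- by move=> i ik; rewrite Ei nb.
- by rewrite -hit_across.
exists c2; split=> //; first by rewrite hit_across.
by rewrite gE; have [->] := inv _ cP _ dD.
Qed.

(** The value of [g] on the beam arriving at a boundary pane depends only on the pane ([val_inj])
    and is preserved by [billiards] ([val_step]), hence is constant on cycles. *)
Lemma trajectory_universal (P : grid_polygon) (T : Type) (g : cell -> vertex -> T) c d c' d' :
  light_invariant P g -> c \in cells P -> c' \in cells P ->
  d \in beam_directions -> d' \in beam_directions ->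
  trajectory P c d = trajectory P c' d' -> g c d = g c' d'.
Proof.
move=> inv cP c'P dD d'D.
pose val (i : 'I_(size (panes P))) t := exists z e,
  [/\ z \in cells P, e \in beam_directions, entry z e + e = (panes P)`_i & g z e = t].
have val_inj i t t' : val i t -> val i t' -> t = t'.
  move=> [z [e [zP eD zE <-]]] [z' [e' [z'P e'D z'E <-]]].
  have : (panes P)`_i \in boundary_panes P by rewrite -mem_panes mem_nth.
  case/boundary_paneP=> z0 _ uz; have [_ qz] := mem_entry z eD.
  have [_ qz'] := mem_entry z' e'D; rewrite zE in qz; rewrite z'E in qz'.
  rewrite -z'E in zE; move: zE; rewrite (uz _ zP qz) (uz _ z'P qz') => zE.
  by rewrite (exit_inj eD e'D zE).
have val_hit (i : 'I_(size (panes P))) z e : z \in cells P -> e \in beam_directions -> hit P z e = (panes P)`_i ->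
    val i (g z e).
  move=> zP eD zE; have [z' [z'P _ z'E <-]] := light_invariant_hit inv zP eD.
  by exists z', e; rewrite -zE.
have val_step (i : 'I_(size (panes P))) t : val i t -> val (billiards P i) t.
  move=> [z [e [zP eD zE <-]]]; have qb : (panes P)`_i \in boundary_panes P.
    by rewrite -mem_panes mem_nth.
  have nP : across z e \notin cells P.
    by move: qb; rewrite -zE exit_boundary // zP; case: (_ \in _).
  have /light_invariant_acrossP/(_ _ zP _ eD)[_ /(_ nP)->] := inv.
  have tD := turn_direction z e; have [j jE] := hit_pane zP tD.
  have -> : billiards P i = j.
    by apply/billiardsP; rewrite -zE -jE -entry_turn //; apply: hit_beam.
  exact: val_hit.
have [i iE] := hit_pane cP dD; have [j jE] := hit_pane c'P d'D.
rewrite (trajectoryE iE) (trajectoryE jE) => /eqP; rewrite eq_porbit_mem => /porbitP[k kE].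
apply: (val_inj i); first exact: val_hit.
rewrite kE; elim: k {kE} => [|k IH]; first by rewrite expg0 perm1; apply: val_hit.
by rewrite expgSr permM; apply: val_step.
Qed.

(** * Bridges *)

Lemma cell_panes_uniq c : uniq (cell_panes c).
Proof. by case: c => [[x y] []]; rewrite /= !inE /e1 /e2 !pairE !xpair_eqE /=; lia. Qed.

Lemma pane_cells q c c' : q \in cell_panes c -> q \in cell_panes c' -> c != c' ->
  (forall z, (q \in cell_panes z) = (z == c) || (z == c')) /\ c'.2 = ~~ c.2.
Proof.
move=> qc; have [v [w [vw qE _ _]]] := cell_pane_ends qc.
move: qc; rewrite {}qE {q}; pattern v, w; apply: adjacent_wlog vw => {v w} v.
- by move=> w H; rewrite addrC.
- rewrite !mem_pane_e1 => /orP[]/eqP-> /orP[]/eqP->; rewrite ?eqxx // => _;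
  by split=> // z; rewrite mem_pane_e1 // orbC.
- rewrite !mem_pane_e2 => /orP[]/eqP-> /orP[]/eqP->; rewrite ?eqxx // => _;
  by split=> // z; rewrite mem_pane_e2 // orbC.
- rewrite !mem_pane_e12 => /orP[]/eqP-> /orP[]/eqP->; rewrite ?eqxx // => _;
  by split=> // z; rewrite mem_pane_e12 // orbC.
Qed.

Definition cell_sign (c : cell) : rat := if c.2 then 1 else -1.

(* The sign of the cells turns the divergence into a plain sum over the panes, *)
(* so that a circulation is a closed cochain.                                  *)
Definition flow (P : {fset cell}) (p : pane) (c c' : cell) (phi : pane -> rat) : Prop :=
  [/\ phi p = 0,
      forall q z, phi q != 0 -> q \in cell_panes z -> z \in P &
      forall z, \sum_(q <- cell_panes z) phi q =
                cell_sign z * ((z == c)%:R - (z == c')%:R)].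

Lemma flow_add P p c c' c'' f f' : flow P p c c' f -> flow P p c' c'' f' ->
  flow P p c c'' (fun q => f q + f' q).
Proof.
move=> [fp fs fd] [fp' fs' fd']; split=> [|q z|z]; first by rewrite fp fp' addr0.
  have [->|fq _] := eqVneq (f q) 0; first by rewrite add0r; apply: fs'.
  exact: fs.
by rewrite big_split /= fd fd' -mulrDr addrA subrK.
Qed.

Lemma crossing_sum q c c' z : q \in cell_panes c -> q \in cell_panes c' -> c != c' ->
  \sum_(x <- cell_panes z) cell_sign c * (x == q)%:R =
  cell_sign z * ((z == c)%:R - (z == c')%:R).
Proof.
move=> qc qc' cc'; have [qE cE] := pane_cells qc qc' cc'; rewrite -mulr_sumr.
have -> : \sum_(x <- cell_panes z) (x == q)%:R = (q \in cell_panes z)%:R :> rat.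
  have [qz|qz] := boolP (q \in cell_panes z).
    rewrite (bigD1_seq q) ?cell_panes_uniq //= eqxx big1 ?addr0 // => x.
    by move=> /negPf->.
  by rewrite big1_seq // => x /= xz; case: eqP => // xq; rewrite -xq xz in qz.
rewrite qE; have [->|zc] := eqVneq z c; first by rewrite (negPf cc') subr0.
have [->|zc'] := eqVneq z c'; last by rewrite subr0 !mulr0.
by rewrite /cell_sign cE; case: (c.2) => /=; lra.
Qed.

Lemma flow_crossing P p q c c' : c \in P -> c' \in P -> c != c' ->
  q \in cell_panes c -> q \in cell_panes c' -> q != p ->
  flow P p c c' (fun x => cell_sign c * (x == q)%:R).
Proof.
move=> cP c'P cc' qc qc' qp; have [qE _] := pane_cells qc qc' cc'.
split=> [|x z|z] /=; first by rewrite eq_sym (negPf qp) mulr0.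
  by have [->|_] := eqVneq x q; rewrite ?mulr0 ?eqxx // qE => _ /orP[]/eqP->.
exact: crossing_sum.
Qed.

Lemma flow0 P p c : flow P p c c (fun=> 0).
Proof. by split=> [//|q z|z]; rewrite ?eqxx // big1 // subrr mulr0. Qed.

(** Each move of a path in [A] contributes a unit flow through the pane crossed, which is never [p],
    as [p] is a side of at most one cell of [A]. *)
Lemma linked_flow P A p c c' : A `<=` P ->
  {in A &, forall z z', p \in cell_panes z -> p \in cell_panes z' -> z = z'} ->
  linked A c c' -> exists f, flow P p c c' f.
Proof.
move=> /fsubsetP AP pA; elim=> [{}c|{}c x y cA xA [q qc qx] _ [f fE]].
  by exists (fun=> 0); apply: flow0.
have [E|cx] := eqVneq c x; first by exists f; rewrite E.
exists (fun q' => cell_sign c * (q' == q)%:R + f q'); apply: flow_add fE.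
apply: flow_crossing => //; try exact: AP.
by apply: contra_neq cx => qp; rewrite qp in qc qx; apply: pA.
Qed.

Definition pane_cochain (phi : pane -> rat) : cochain :=
  Cochain (fun v => phi (v + (v + e1))) (fun v => phi (v + (v + e2)))
          (fun v => phi ((v + e1) + (v + e2))).

(* If the two sides of p were joined by a second way, a unit flow could        *)
(* circulate through p, but its potential vanishes at both ends of p.          *)
Lemma bridge P s (A B : {fset cell}) v w p' c1 c2 c1' c2' :
  clockwise_boundary P s -> A `<=` P -> B `<=` P -> A `&` B = fset0 ->
  {in A &, forall c c', linked A c c'} -> {in B &, forall c c', linked B c c'} ->
  adjacent v w -> v \in s -> w \in s ->
  c1 \in A -> v + w \in cell_panes c1 -> c2 \in B -> v + w \in cell_panes c2 ->
  c1' \in A -> p' \in cell_panes c1' -> c2' \in B -> p' \in cell_panes c2' ->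
  p' = v + w.
Proof.
move=> cb AP BP AB linkA linkB vw vs ws c1A pc1 c2B pc2 c1'A p'c1 c2'B p'c2.
have neq a b : a \in A -> b \in B -> a != b.
  move=> aA bB; apply/eqP => E; have : a \in A `&` B by rewrite inE aA E bB.
  by rewrite AB.
have [/fsubsetP AP' /fsubsetP BP'] := (AP, BP).
apply/eqP/negPn/negP => pp'; set p := v + w in pc1 pc2 pp'.
have [pE _] := pane_cells pc1 pc2 (neq _ _ c1A c2B).
have [f1 F1] : exists f, flow P p c1 c1' f.
  apply: linked_flow AP _ (linkA _ _ c1A c1'A) => z z' zA z'A.
  rewrite !pE (negPf (neq z c2 _ _)) // (negPf (neq z' c2 _ _)) // !orbF.
  by move=> /eqP-> /eqP->.
have [f2 F2] : exists f, flow P p c2' c2 f.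
  apply: linked_flow BP _ (linkB _ _ c2'B c2B) => z z' zB z'B.
  rewrite !pE ![_ == c1]eq_sym (negPf (neq c1 z _ _)) // (negPf (neq c1 z' _ _)) //.
  by move=> /eqP-> /eqP->.
have F := flow_add (flow_add F1 (flow_crossing (AP' _ c1'A) (BP' _ c2'B)
  (neq _ _ c1'A c2'B) p'c1 p'c2 pp')) F2.
set f := fun q => _ in F; case: F => fp fs fd.
(* Returning from [c2] to [c1] through [p] turns the flow into a circulation; its value on [p] is
   not 0, because [f] vanishes there. *)
pose phi q := f q + cell_sign c2 * (q == p)%:R.
have c21 : c2 != c1 by rewrite eq_sym neq.
have phid z : \sum_(q <- cell_panes z) phi q = 0.
  by rewrite big_split /= fd (crossing_sum _ pc2 pc1 c21); lra.
have phis q z : phi q != 0 -> q \in cell_panes z -> z \in P.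
  rewrite /phi; have [->|qp] := eqVneq q p; last by rewrite mulr0 addr0; apply: fs.
  by rewrite pE => _ /orP[]/eqP->; [apply: AP'|apply: BP'].
have phi0 : phi p != 0.
  by rewrite /phi fp eqxx add0r mulr1 /cell_sign; case: ifP.
have cl : closed_cochain (pane_cochain phi).
  move=> u; have := phid (u, true); have := phid (u, false).
  by rewrite !big_cons !big_nil /= (addrAC u e2 e1); lra.
have win : inside P (pane_cochain phi).
  move=> u; split=> /= nP; apply/eqP; apply: contraNT nP => /phis H; apply/andP; split;
    by apply: H; rewrite ?mem_pane_e1 ?mem_pane_e2 ?mem_pane_e12 eqxx ?orbT.
have [v0 v0s Pb] := rightmost_boundary cb.
have supp := inside_supported Pb win.
have X0 := potential_boundary cb v0s Pb win cl.
case/eqP: phi0; have : potential v0.1 (pane_cochain phi) v = potential v0.1 (pane_cochain phi) w.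
  by rewrite !X0.
rewrite /p; pattern v, w; apply: adjacent_wlog vw => u.
- by move=> u' H E; rewrite addrC H.
- by rewrite potential_e1 //=; lra.
- by rewrite potential_e2 //=; lra.
- by rewrite potential_e12 //=; lra.
Qed.

(** * Disjoint unions of unit hexagons *)

Lemma cell_vertices_adjacent c u v :
  u \in cell_vertices c -> v \in cell_vertices c -> u != v -> adjacent u v.
Proof.
case: c u v => [[x y] b] [u1 u2] [v1 v2]; rewrite cell_verticesE /adjacent pairE pairD.
case: b; rewrite /= !inE /e1 /e2 !pairE !xpair_eqE /=; lia.
Qed.

Lemma ccw60_6 d : ccw60 (ccw60 (ccw60 (ccw60 (ccw60 (ccw60 d))))) = d.
Proof. by case: d => a b; rewrite /ccw60 /=; congr pair; lia. Qed.

Lemma units_rotations d d' : d \in units -> d' \in units ->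
  [\/ d' = d, d' = ccw60 d \/ d = ccw60 d',
      d' = ccw60 (ccw60 d) \/ d = ccw60 (ccw60 d') |
      d' = ccw60 (ccw60 (ccw60 d))].
Proof.
move=> h h'; unit_cases h; unit_cases h';
  by [constructor 1|constructor 2; left|constructor 2; right
     |constructor 3; left|constructor 3; right|constructor 4].
Qed.

Lemma ccw60_sub d : d \in units -> ccw60 d - d \in units.
Proof. by move=> h; unit_cases h. Qed.

Lemma hexagon_linked u : {in unit_hexagon u &, forall c c', linked (unit_hexagon u) c c'}.
Proof.
have cornerP d : d \in units -> corner u d \in unit_hexagon u.
  by move=> dU; rewrite in_unit_hexagon corner_vertices // mem_head.
have DU k : iter k ccw60 e1 \in units by elim: k => //= k; apply: ccw60_unit.
have E k : linked (unit_hexagon u) (corner u e1) (corner u (iter k ccw60 e1)).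
  elim: k => [|k IH]; first exact: linked_refl.
  apply: linked_trans IH (linked1 (cornerP _ (DU k)) (cornerP _ (DU k.+1)) _).
  exists (u + (u + iter k.+1 ccw60 e1)); rewrite pane_corners ?DU //= ?eqxx //.
  by rewrite ccw60K eqxx orbT.
have {}E c : c \in unit_hexagon u -> linked (unit_hexagon u) (corner u e1) c.
  rewrite in_unit_hexagon => /corner_of_vertex[d dU ->].
  by unit_cases dU; [exact: (E 0%N)|exact: (E 1%N)|exact: (E 2%N)|exact: (E 3%N)
                    |exact: (E 4%N)|exact: (E 5%N)].
by move=> c c' cH c'H; apply: linked_trans (linked_sym (E _ cH)) (E _ c'H).
Qed.

Lemma linked_exit P A c z : linked P c z -> c \in A -> z \notin A ->
  exists y y', [/\ y \in P, y' \in P, y \in (A : {fset cell}), y' \notin A & neighbors y y'].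
Proof.
elim=> [{}c cA|{}c x y cP xP cx _ IH cA yA]; first by rewrite cA.
by have [xA|xA] := boolP (x \in A); [exact: IH|exists c, x].
Qed.

(* Otherwise four boundary panes would meet at u.                              *)
Lemma hexagons_share_pane P s a b u : clockwise_boundary P s ->
  {in P, forall c, exists2 v, v \in interior P & v \in cell_vertices c} ->
  {in interior P &, forall u v, ~ adjacent u v} ->
  a \in interior P -> b \in interior P -> a != b -> u \notin interior P ->
  adjacent u a -> adjacent u b ->
  exists w c c', [/\ adjacent u w, c \in unit_hexagon a, c' \in unit_hexagon b,
                     u + w \in cell_panes c & u + w \in cell_panes c'].
Proof.
move=> cb center indep.
have main d d' : d \in units -> u + d \in interior P -> u + d' \in interior P ->
    d' = ccw60 (ccw60 d) ->
    exists w c c', [/\ adjacent u w, c \in unit_hexagon (u + d),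
      c' \in unit_hexagon (u + d'), u + w \in cell_panes c & u + w \in cell_panes c'].
  move=> dU aI bI ->; have d1U := ccw60_unit dU.
  exists (u + ccw60 d), (corner u d), (corner u (ccw60 d)).
  rewrite !in_unit_hexagon !corner_vertices // !pane_corners // !inE !eqxx ?orbT.
  by rewrite ccw60K eqxx ?orbT; split=> //; apply: adjacent_unit.
move=> aI bI ab uI ua ub.
have aE : a = u + (a - u) by rewrite addrC subrK.
have bE : b = u + (b - u) by rewrite addrC subrK.
move: (a - u) (b - u) (ua : a - u \in units) (ub : b - u \in units) aE bE => d d' dU d'U.
move=> aE bE; subst a b; have far e e' : e \in units -> e' \in units ->
    u + e \in interior P -> e' = ccw60 e \/ e = ccw60 e' -> u + e' \notin interior P.
  move=> eU e'U eI E; apply/negP => e'I; apply: (indep _ _ eI e'I).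
  have subE x y : (u + x) - (u + y) = x - y by rewrite opprD addrACA subrr add0r.
  rewrite /adjacent subE; case: E => ->; first exact: ccw60_sub.
  by rewrite -opprB; apply/opp_unit/ccw60_sub.
have [E|E|[E|E]|E] := units_rotations dU d'U.
- by rewrite E eqxx in ab.
- by have := far _ _ dU d'U aI E; rewrite bI.
- exact: main E.
- by have [w [c [c' [? ? ? ? ?]]]] := main _ _ d'U bI aI E; exists w, c', c.
(* Now the two centres are opposite each other about [u]. The cells [corner u d1] and [corner u d4]
   have no interior vertex, so they lie outside [P], and the panes in directions [d1], [d2], [d4]
   are three boundary panes at [u]. *)
subst d'; set d1 := ccw60 d in d'U bI ab *; set d2 := ccw60 d1 in d'U bI ab *.
set d3 := ccw60 d2 in d'U bI ab *; set d4 := ccw60 d3; set d5 := ccw60 d4.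
have d6 : ccw60 d5 = d by exact: ccw60_6.
have d1U : d1 \in units by exact: ccw60_unit.
have d2U : d2 \in units by exact: ccw60_unit.
have d4U : d4 \in units by exact: ccw60_unit.
have d5U : d5 \in units by exact: ccw60_unit.
have out e : e \in units -> u + e \notin interior P -> u + ccw60 e \notin interior P ->
    corner u e \notin P.
  move=> eU n1 n2; apply/negP => /center[v vI]; rewrite corner_vertices // !inE.
  by move=> /or3P[]/eqP vE; rewrite vE ?(negPf uI) ?(negPf n1) ?(negPf n2) in vI.
have o1 : corner u d1 \notin P.
  by apply: out => //; [apply: (far d)|apply: (far d3)] => //; [left|right].
have o4 : corner u d4 \notin P.
  by apply: out => //; [apply: (far d3)|apply: (far d)] => //; [left|right].
have inP e v : e \in units -> v \in interior P -> v \in cell_vertices (corner u e) ->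
    corner u e \in P by move=> _ /interiorP; apply.
have i0 : corner u d \in P by apply: inP aI _; rewrite ?corner_vertices // !inE eqxx orbT.
have i2 : corner u d2 \in P by apply: inP bI _; rewrite ?corner_vertices // !inE eqxx !orbT.
have i3 : corner u d3 \in P by apply: inP bI _; rewrite ?corner_vertices // !inE eqxx orbT.
have b1 : u + (u + d1) \in boundary_panes P.
  by rewrite boundary_corners // ccw60K (negPf o1) i0.
have b2 : u + (u + d2) \in boundary_panes P.
  by rewrite boundary_corners // ccw60K (negPf o1) i2.
have b4 : u + (u + d4) \in boundary_panes P.
  by rewrite boundary_corners // ccw60K (negPf o4) i3.
have n12 : d2 <> d1 by clear -dU; rewrite /d2 /d1; clear -dU; unit_cases dU.
have n14 : d4 <> d1 by rewrite /d4 /d3 /d2 /d1; clear -dU; unit_cases dU.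
have n24 : d4 <> d2 by rewrite /d4 /d3 /d2 /d1; clear -dU; unit_cases dU.
have [E1|E1] := boundary_degree cb d1U b1; have [E2|E2] := boundary_degree cb d2U b2;
  have [E4|E4] := boundary_degree cb d4U b4;
  first [by case: n12; apply: (addrI u); rewrite E1 E2
        |by case: n14; apply: (addrI u); rewrite E1 E4
        |by case: n24; apply: (addrI u); rewrite E2 E4].
Qed.

(** A tree [T] grows by one hexagon at a time. While centres remain, connectedness of [P] yields a
    pane from [T] to a new hexagon; its ends are not interior, so they lie on the curve, and
    [bridge] makes it the only common pane. *)
Lemma hexagons_tree P s : clockwise_boundary P s ->
  {in P, forall c, exists2 v, v \in interior P & v \in cell_vertices c} ->
  {in interior P &, forall u v, ~ adjacent u v} -> tree_of_unit_hexagons P.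
Proof.
move=> cb center indep; set I := interior P in center indep.
have center_uniq c a b : a \in I -> b \in I -> a \in cell_vertices c ->
    b \in cell_vertices c -> a = b.
  move=> aI bI ac bc; apply/eqP/negPn/negP => ab.
  exact: (indep _ _ aI bI (cell_vertices_adjacent ac bc ab)).
have hexP a : a \in I -> unit_hexagon a `<=` P.
  by move/interiorP=> aP; apply/fsubsetP => c; rewrite in_unit_hexagon; apply: aP.
have [c0 c0P] := boundary_cell cb; have [v0 v0I _] := center _ c0P.
have grow n : (n < size I)%N -> exists J T,
    [/\ size J = n.+1, uniq J /\ {subset J <= I}, tree_of_unit_hexagons T,
        forall c, (c \in T) = has (fun a => c \in unit_hexagon a) J &
        {in T &, forall c c', linked T c c'}].
  elim: n => [_|n IH nI].
    exists [:: v0], (unit_hexagon v0); split=> //.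
    - by split=> // v; rewrite inE => /eqP->.
    - exact: TreeHexagon.
    - by move=> c; rewrite /= orbF.
    - exact: hexagon_linked.
  have [J [T [Jn [uJ JI] treeT TE linkT]]] := IH (ltnW nI).
  have TP : T `<=` P.
    apply/fsubsetP => c; rewrite TE => /hasP[a /JI aI]; exact: (fsubsetP (hexP _ aI)).
  have [b0 b0I b0J] : exists2 b, b \in I & b \notin J.
    have [/allP sub|/allPn[b bI bJ]] := boolP (all [in J] I); last by exists b.
    have := uniq_leq_size (fset_uniq I) sub.
    by rewrite Jn leqNgt nI.
  have [a0 a0J] : exists a, a \in J by case: (J) Jn => // a J' _; exists a; apply: mem_head.
  have cell0 a : (a, true) \in unit_hexagon a.
    by rewrite in_unit_hexagon cell_verticesE mem_head.
  have tA : (a0, true) \in T by rewrite TE; apply/hasP; exists a0.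
  have tB : (b0, true) \notin T.
    apply/negP; rewrite TE => /hasP[a aJ]; rewrite in_unit_hexagon => ab.
    case/negP: b0J; rewrite (_ : b0 = a) //; apply: center_uniq ab => //; first exact: JI.
    by rewrite cell_verticesE mem_head.
  have lk : linked P (a0, true) (b0, true).
    apply: linked_cells cb _ _; first exact: (fsubsetP TP).
    exact: (fsubsetP (hexP _ b0I)).
  have [c [c' [cP c'P cT c'T [p pc pc']]]] := linked_exit lk tA tB.
  have [b bI bc'] := center _ c'P; have c'B : c' \in unit_hexagon b by rewrite in_unit_hexagon.
  have bJ : b \notin J.
    by apply: contra c'T => bJ; rewrite TE; apply/hasP; exists b.
  have TB : T `&` unit_hexagon b = fset0.
    apply/eqP; rewrite -fsubset0; apply/fsubsetP => z; rewrite inE TE.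
    move=> /andP[/hasP[a aJ]]; rewrite !in_unit_hexagon => az bz.
    by case/negP: bJ; rewrite (center_uniq z b a) // JI.
  have [v [w [vw pE vc wc]]] := cell_pane_ends pc.
  have := pc'; rewrite pE mem_cell_panes // => /andP[vc' wc'].
  have notI u z z' : z \in T -> z' \in unit_hexagon b -> u \in cell_vertices z ->
      u \in cell_vertices z' -> u \notin I.
    rewrite TE in_unit_hexagon => /hasP[a aJ]; rewrite in_unit_hexagon => az bz' uz uz'.
    apply/negP => uI; case/negP: bJ; rewrite (center_uniq z' b u) // (center_uniq z u a) //.
    exact: JI.
  have in_s u z : z \in P -> u \in cell_vertices z -> u \notin I -> u \in s.
    move=> zP uz; apply: contraNT => us; apply/interiorP => z' uz'.
    by rewrite -(cells_around cb us uz uz').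
  have vs : v \in s by apply: (in_s v c) => //; apply: (notI v c c').
  have ws : w \in s by apply: (in_s w c) => //; apply: (notI w c c').
  have br q z z' : z \in T -> z' \in unit_hexagon b -> q \in cell_panes z ->
      q \in cell_panes z' -> q = v + w.
    move=> zT z'B qz qz'; rewrite pE in pc pc'.
    by apply: (bridge cb TP (hexP _ bI) TB linkT (@hexagon_linked b) vw vs ws cT pc c'B pc'
      zT qz z'B qz').
  have meet : meet_in_single_pane T (unit_hexagon b).
    exists v, w; split=> //; apply/fsetP => u; rewrite !inE; apply/andP/idP.
    - case=> /bigfcupP[z /andP[zT _]]; rewrite inE /= => uz.
      case=> /bigfcupP[z' /andP[z'B _]]; rewrite inE /= => uz'.
      have uI := notI u z z' zT z'B uz uz'.
      have := zT; rewrite TE => /hasP[a aJ]; rewrite in_unit_hexagon => az.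
      have aI := JI _ aJ.
      have ab : a != b by apply: contraNneq bJ => <-.
      have bz' : b \in cell_vertices z' by rewrite -in_unit_hexagon.
      have ua : adjacent u a by apply: cell_vertices_adjacent uz az _; apply: contraNneq uI => ->.
      have ub : adjacent u b by apply: cell_vertices_adjacent uz' bz' _; apply: contraNneq uI => ->.
      (* A common vertex is thus an end of a common pane, and [br] identifies that pane with
         [v + w]. *)
      have [t [y [y' [ut ya yb qy qy']]]] := hexagons_share_pane cb center indep aI bI ab uI ua ub.
      have yT : y \in T by rewrite TE; apply/hasP; exists a.
      have /(pane_ends ut vw)[[-> _]|[-> _]] := br _ _ _ yT yb qy qy'; rewrite eqxx ?orbT //.
    - move=> uvw; split; apply/bigfcupP; [exists c|exists c']; rewrite ?andbT // inE /=;
      by case/orP: uvw => /eqP->.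
    - case=> /mem_region_panes[z zT qz] /mem_region_panes[z' z'B qz'].
      by apply/eqP; apply: br qz qz'.
    - by move=> /eqP->; split; apply/mem_region_panes; [exists c|exists c']; rewrite // -pE.
  exists (b :: J), (T `|` unit_hexagon b); split.
  - by rewrite /= Jn.
  - by rewrite /= bJ uJ; split=> // z; rewrite inE => /orP[/eqP->|/JI].
  - exact: TreeAttach.
  - by move=> z; rewrite inE TE /= orbC.
  - have lT := linked_sub (fsubsetUl T (unit_hexagon b)).
    have lB := linked_sub (fsubsetUr T (unit_hexagon b)).
    have lcc : linked (T `|` unit_hexagon b) c c'.
      apply: linked1; first by rewrite inE cT.
        by rewrite inE c'B orbT.
      by exists p.
    have toc z : z \in T `|` unit_hexagon b -> linked (T `|` unit_hexagon b) z c.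
      rewrite inE => /orP[zT|zB]; first exact/lT/linkT.
      by apply: linked_trans (linked_sym lcc); apply/lB/hexagon_linked.
    by move=> z z' /toc zc /toc z'c; apply: linked_trans zc (linked_sym z'c).
have I0 : (0 < size I)%N by case: (enum_fset I) (v0I : v0 \in enum_fset I).
have [|J [T [Jn [uJ JI] treeT TE _]]] := grow (size I).-1; first by rewrite prednK.
have JE : J =i I.
  by have [|_ //] := uniq_min_size uJ JI; rewrite Jn prednK.
suff <- : T = P by [].
apply/fsetP => c; rewrite TE; apply/hasP/idP => [[a aJ ca]|cP].
  by apply: (fsubsetP (hexP a _)) ca; rewrite -JE.
by have [a aI ac] := center _ cP; exists a; rewrite ?JE // in_unit_hexagon.
Qed.

(** * Trajectories in a tree of unit hexagons *)

Lemma entry_inj c d d' : d \in beam_directions -> d' \in beam_directions ->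
  entry c d = entry c d' -> d = d'.
Proof.
move=> dD d'D E; have [qc rc] := mem_entry c dD; have [_ rc'] := mem_entry c d'D.
by apply: (cell_panes_dir_uniq qc) => //; rewrite E.
Qed.

Lemma across_orientation c d : (across c d).2 = ~~ c.2.
Proof. by case: c => v []; rewrite /across; do 2?case: ifP. Qed.

(* The beam direction parallel to the side of c opposite to its vertex v.      *)
Definition facing (v : vertex) (c : cell) : vertex :=
  if c.2 then
    if v == c.1 then southeast else if v == c.1 + e1 then northeast else west
  else
    if v == c.1 + e1 then west else if v == c.1 + e2 then northeast else southeast.

(* The two trajectories of the unit hexagon centred at v, told apart by t.     *)
Definition hexagon_light (v : vertex) (t : bool -> bool) (c : cell) (d : vertex) : bool :=
  t (c.2 (+) (d == facing v c)).

(** A beam crossing a pane at [v] changes both the orientation of its cell and whether it is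
    [facing], so the exclusive or is kept; at an outer side neither the arriving nor the reflected
    beam is [facing]. *)
Lemma hexagon_light_across v t c d : v \in cell_vertices c -> d \in beam_directions ->
  (v \in cell_vertices (across c d) ->
     hexagon_light v t c d = hexagon_light v t (across c d) d) /\
  (v \notin cell_vertices (across c d) ->
     hexagon_light v t c d = t c.2 /\ hexagon_light v t c (turn c d) = t c.2).
Proof.
case: v => x y /corner_of_vertex[e eU ->] dD; case/beam_directionP: dD => ->;
  unit_cases eU; rewrite /corner /=; rewrite /hexagon_light /facing /across /turn /=.
all: rewrite ?cell_verticesE /= /e1 /e2 ?pairE !inE !xpair_eqE /=; split=> H.
all: by do ?case: ifP => ?; try by exfalso; lia.
Qed.

Lemma hexagon_light_invariant v t :
  light_invariant (unit_hexagon v) (hexagon_light v t).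
Proof.
apply/light_invariant_acrossP => c; rewrite in_unit_hexagon => vc d dD.
have [H1 H2] := hexagon_light_across t vc dD.
by rewrite in_unit_hexagon; split=> // /H2[-> ->].
Qed.

Lemma light_invariant_union (T : Type) (A B : {fset cell}) p
    (gA gB : cell -> vertex -> T) y :
  light_invariant A gA -> light_invariant B gB -> A `&` B = fset0 ->
  region_panes A `&` region_panes B = [fset p] ->
  {in A, forall c, {in beam_directions, forall d,
     entry c d = p \/ entry c d + d = p -> gA c d = y}} ->
  {in B, forall c, {in beam_directions, forall d,
     entry c d = p \/ entry c d + d = p -> gB c d = y}} ->
  light_invariant (A `|` B) (fun c d => if c \in A then gA c d else gB c d).
Proof.
move=> /light_invariant_acrossP invA /light_invariant_acrossP invB AB pAB yA yB.
have disj c : c \in B -> (c \in A) = false.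
  move=> cB; apply/negP => cA; have : c \in A `&` B by rewrite inE cA cB.
  by rewrite AB.
have common q c c' : c \in A -> c' \in B -> q \in cell_panes c -> q \in cell_panes c' ->
    q = p.
  move=> cA c'B qc qc'; apply/fset1P; rewrite -pAB inE; apply/andP.
  by split; apply/mem_region_panes; [exists c|exists c'].
apply/light_invariant_acrossP => c; rewrite inE => cAB d dD; rewrite inE.
have [qz _] := mem_entry (across c d) dD; have zE := entry_across c dD.
have [_ rc] := mem_entry c dD; rewrite -zE in rc.
set z := across c d in qz zE *; case/orP: cAB => [cA|cB].
  have [H1 H2] := invA _ cA _ dD; rewrite cA; split=> [|nz]; last first.
    by apply: H2; apply: contra nz => ->.
  have [zA _|_ zB] := boolP (z \in A); first exact: H1.
  have E := common _ _ _ cA zB rc qz.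
  by rewrite (yA _ cA _ dD) ?(yB _ zB _ dD) -?zE; [|left|right].
have [H1 H2] := invB _ cB _ dD; rewrite (disj c) //; split=> [|nz]; last first.
  by apply: H2; apply: contra nz => ->; rewrite orbT.
have [zA _|_ zB] := boolP (z \in A); last exact: H1.
have E := common _ _ _ zA cB qz rc.
by rewrite (yB _ cB _ dD) ?(yA _ zA _ dD) -?zE; [|left|right].
Qed.

Lemma light_boundary_value (T : Type) A p c (g : cell -> vertex -> T) :
  light_invariant A g -> p \in boundary_panes A -> c \in A -> p \in cell_panes c ->
  exists y, {in A, forall c, {in beam_directions, forall d,
    entry c d = p \/ entry c d + d = p -> g c d = y}}.
Proof.
move=> /light_invariant_acrossP inv /boundary_paneP[c0 _ uc] cA pc.
have [d dD E] := exit_of_pane pc; exists (g c d) => c' c'A d' d'D.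
have H q : q \in cell_panes c' -> q = p -> c' = c.
  by move=> + qp; rewrite qp => pc'; rewrite (uc _ c'A pc') (uc _ cA pc).
have [q1 q2] := mem_entry c' d'D; case=> E'.
  have cc := H _ q1 E'; subst c'; have nA : across c d \notin A.
    have [qz _] := mem_entry (across c d) dD; rewrite entry_across // E in qz.
    apply/negP => zA; have := congr1 snd (etrans (uc _ zA qz) (esym (uc _ cA pc))).
    by rewrite across_orientation; case: (c.2).
  have [_ /(_ nA) ->] := inv _ cA _ dD; congr (g c _); apply: (entry_inj (c := c)) => //.
    exact: turn_direction.
  by rewrite entry_turn // E' E.
have cc := H _ q2 E'; subst c'; congr (g c _); apply: (exit_inj (c := c)) => //.
by rewrite E' E.
Qed.

Lemma hexagon_light_outer v t p c : p \in cell_panes c ->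
  v \in cell_vertices c -> p \in boundary_panes (unit_hexagon v) ->
  {in unit_hexagon v, forall c', {in beam_directions, forall d,
    entry c' d = p \/ entry c' d + d = p -> hexagon_light v t c' d = t c.2}}.
Proof.
move=> pc vc pb; have cB : c \in unit_hexagon v by rewrite in_unit_hexagon.
have [y yE] := light_boundary_value (hexagon_light_invariant v t) pb cB pc.
have [d dD E] := exit_of_pane pc; suff -> : t c.2 = y by [].
rewrite -(yE _ cB _ dD (or_intror E)).
have [_ H] := hexagon_light_across t vc dD.
have [|-> //] := H; rewrite -in_unit_hexagon.
by move: pb; rewrite -E exit_boundary // cB; case: (_ \in _).
Qed.

Lemma unit_hexagon_card v : #|` unit_hexagon v| = 6%N.
Proof.
pose s : seq cell := [:: (v, true); (v - e1, true); (v - e2, true);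
              (v - e1, false); (v - e2, false); (v - e1 - e2, false)].
have us : uniq s.
  by rewrite {}/s; case: v => x y; rewrite /= !inE /e1 /e2 !pairE !xpair_eqE /=; lia.
have := perm_size (uniq_perm (fset_uniq (unit_hexagon v)) us _); apply=> c.
by rewrite -[LHS]/(c \in unit_hexagon v) /unit_hexagon in_fset.
Qed.

(** Free prescription of values on [S] expresses that its segments lie on different trajectories,
    without requiring a boundary curve or a permutation for [A]; this suits induction on trees. *)
Definition light_flags (A : {fset cell}) (S : seq (cell * vertex)) : Prop :=
  [/\ uniq S, {in S, forall x, x.1 \in A /\ x.2 \in beam_directions} &
   forall b : cell * vertex -> bool, exists2 g : cell -> vertex -> bool,
     light_invariant A g & {in S, forall x, g x.1 x.2 = b x}].

Lemma hexagon_flags v :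
  light_flags (unit_hexagon v) [:: ((v, true), west); ((v - e1, false), southeast)].
Proof.
split=> [|x|b]; first by rewrite /= inE !xpair_eqE /= andbF.
  by rewrite !inE => /orP[]/eqP->; rewrite /= ?eqxx ?orbT.
exists (hexagon_light v (fun up => b (if up then ((v, true), west)
                                     else ((v - e1, false), southeast)))).
  exact: hexagon_light_invariant.
by move=> x; rewrite !inE => /orP[]/eqP->; rewrite /hexagon_light /facing /= ?subrK ?eqxx.
Qed.

Lemma disjoint_boundary (A B : {fset cell}) p c c' : A `&` B = fset0 ->
  c \in A -> p \in cell_panes c -> c' \in B -> p \in cell_panes c' ->
  p \in boundary_panes A.
Proof.
move=> AB cA pc c'B pc'; have dis z : z \in A -> z \in B -> False.
  by move=> zA zB; suff : z \in A `&` B; [rewrite AB|rewrite inE zA zB].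
have cc' : c != c' by apply/eqP => E; apply: (dis c) => //; rewrite E.
have [pE _] := pane_cells pc pc' cc'.
apply/boundary_paneP; exists c => // z zA; rewrite pE => /orP[]/eqP // zE.
by case: (dis z zA); rewrite zE.
Qed.

(** The shared pane forces the value [y] on one of the two trajectories of the hexagon. The other
    one reaches only outer sides of cells oriented unlike [c'], so it stays free; [x] is a segment
    of it. *)
Lemma attach_flags A v S : light_flags A S -> meet_in_single_pane A (unit_hexagon v) ->
  exists x, light_flags (A `|` unit_hexagon v) (x :: S).
Proof.
move=> [uS AS gS] [u [w [uw _ pAB AB]]]; set B := unit_hexagon v in pAB AB *.
set p := u + w in pAB; have : p \in region_panes A `&` region_panes B by rewrite pAB fset11.
rewrite inE => /andP[/mem_region_panes[c cA pc] /mem_region_panes[c' c'B pc']].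
have pA := disjoint_boundary AB cA pc c'B pc'.
have pB : p \in boundary_panes B by apply: (disjoint_boundary _ c'B pc' cA pc); rewrite fsetIC.
have vc' : v \in cell_vertices c' by rewrite -in_unit_hexagon.
have dis z : z \in B -> (z \in A) = false.
  by move=> zB; apply/negP => zA; suff : z \in A `&` B; [rewrite AB|rewrite inE zA zB].
pose x : cell * vertex := if c'.2 then ((v - e1, false), southeast) else ((v, true), west).
have xB : x.1 \in B by rewrite /x; case: ifP => _;
  rewrite in_unit_hexagon cell_verticesE /= ?subrK mem_head.
exists x; split=> [|z|b].
- rewrite /= uS andbT; apply/negP => /AS[xA _]; by rewrite dis in xA.
- rewrite inE => /orP[/eqP->|/AS[-> ?]] //.
  by rewrite xB orbT; split=> //; rewrite /x; case: ifP.
have [g inv gE] := gS b; have [y yE] := light_boundary_value inv pA cA pc.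
pose t up := if up == c'.2 then y else b x.
have tE : t c'.2 = y by rewrite /t eqxx.
have hE := hexagon_light_outer t pc' vc' pB; rewrite tE in hE.
have inv' := light_invariant_union inv (hexagon_light_invariant v t) AB pAB yE hE.
eexists; first exact: inv'.
move=> z; rewrite inE => /orP[/eqP->|zS] /=; last by have [-> _] := AS _ zS; apply: gE.
rewrite dis // /hexagon_light /facing /t /x.
by case: (c'.2); rewrite /= ?subrK ?eqxx.
Qed.

Lemma tree_flags A : tree_of_unit_hexagons A ->
  exists S, light_flags A S /\ (6 * size S = #|` A| + 6)%N.
Proof.
elim=> [v|{}A v _ [S [AS sE]] meet].
  by exists [:: ((v, true), west); ((v - e1, false), southeast)]; split;
    [exact: hexagon_flags|rewrite unit_hexagon_card].
have [x xS] := attach_flags AS meet; exists (x :: S); split=> //.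
have [_ [_ [_ _ _ AB]]] := meet.
have := cardfsUI A (unit_hexagon v); rewrite AB cardfs0 addn0 unit_hexagon_card => ->.
by rewrite /= mulnS sE addnC.
Qed.

(** * Comparison with the cycles of the billiards permutation *)

Lemma cyc_classes (P : grid_polygon) :
  light_classes P (trajectory P) (enum (porbits (billiards P))).
Proof.
split; [exact: trajectory_invariant|exact: enum_uniq|move=> o; rewrite mem_enum].
move=> /imsetP[i _ ->]; have [c [d [cP dD _ E]]] := trajectory_surjective i.
by exists c, d; rewrite E.
Qed.

Lemma cyc_size (P : grid_polygon) : size (enum (porbits (billiards P))) = cyc P.
Proof. by rewrite /cyc cardE. Qed.

(** If two flags lay on one cycle, an invariant true at just one of them would contradict
    [trajectory_universal]. *)
Lemma flags_cyc (P : grid_polygon) S : light_flags P S -> (size S <= cyc P)%N.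
Proof.
move=> [uS PS gS]; rewrite -cyc_size -(size_map (fun x => trajectory P x.1 x.2)).
apply: uniq_leq_size => [|o /mapP[x /PS[cP dD] ->]].
  rewrite map_inj_in_uniq // => x x' xS x'S E; have [cP dD] := PS _ xS.
  have [c'P d'D] := PS _ x'S; have [g inv gE] := gS (fun z => z == x).
  have := trajectory_universal inv cP c'P dD d'D E.
  by rewrite !gE // eqxx => /esym/eqP.
have [i iE] := hit_pane cP dD; rewrite (trajectoryE iE) mem_enum.
exact: imset_f.
Qed.

Theorem theorem1p3 (P : grid_polygon) :
  ((area P)%:Z = 6 * (cyc P)%:Z - 6)%R <-> tree_of_unit_hexagons P.
Proof.
have lc := cyc_classes P; have cb := grid_polygonP P.
have le := light_classes_area cb lc; rewrite cyc_size in le.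
split=> [E|/tree_flags[S [PS SE]]].
  have [|center indep] := light_classes_extremal cb lc; last exact: hexagons_tree cb center indep.
  by rewrite cyc_size; move: E; rewrite /area; lia.
have := flags_cyc PS; rewrite /area; lia.
Qed.
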